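(* Let $\Lambda=\mathrm{diag}(\lambda_1<\cdots<\lambda_n)$ be a weak a.p. matrix and $\sigma:\mathcal{T}_\Lambda\to\mathbb{R}$ a simple shift strategy for which $\mathcal{C}_{\Lambda,0}$ and $\mathcal{S}_\sigma$ are disjoint. Then there exists $\epsilon>0$ such that the deflation neighborhood $\mathcal{D}_{\Lambda,\epsilon}$ is invariant under $F_\sigma$ and, for all unreduced $T\in\mathcal{D}_{\Lambda,\epsilon}$, the sequence $(b(F_\sigma^k(T)))$ converges to zero at a rate which is at least cubic. More precisely, for each unreduced $T\in\mathcal{D}_{\Lambda,\epsilon}$ there exist $C_T,K_T>0$ such that, for all $k>K_T$, $|b(F_\sigma^{k+1}(T))|\le C_T|b(F_\sigma^k(T))|^3$.
   Context: A matrix with simple real spectrum $\lambda_1<\dots<\lambda_n$ is a.p. if it has three eigenvalues in arithmetic progression; an a.p. matrix is strong a.p. if three consecutive eigenvalues $\lambda_{j},\lambda_{j+1},\lambda_{j+2}$ are in arithmetic progression, and weak a.p. otherwise. $\mathcal{T}_\Lambda$ is the set of real symmetric tridiagonal $n\times n$ matrices with spectrum $\{\lambda_1,\dots,\lambda_n\}$ (a connected compact smooth manifold); $b(T)=(T)_{n,n-1}$; $T$ is unreduced if all $(T)_{i+1,i}$, $1\le i<n$, are nonzero. $\mathcal{D}_{\Lambda,\epsilon}=\{T\in\mathcal{T}_\Lambda: |b(T)|\le\epsilon\}$ and $\mathcal{C}_{\Lambda,0}=\{T\in\mathcal{T}_\Lambda: (T)_{n,n-1}=(T)_{n-1,n-2}=0\}$.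 $\mathcal{E}$ is the group of diagonal matrices with diagonal entries $\pm1$. Steps: an $n\times n$ real matrix is almost invertible if its first $n-1$ columns are linearly independent. Every almost invertible $M$ has a unique factorization $M=Q_\star R_\star$ with $Q_\star\in SO(n)$ and $R_\star$ upper triangular with $(R_\star)_{i,i}>0$ for $i=1,\dots,n-1$. If $T-sI$ is almost invertible and $T-sI=Q_\star R_\star$, put $F_s(T)=Q_\star^{*}TQ_\star$. For $\sigma:\mathcal{T}_\Lambda\to\mathbb{R}$ put $F_\sigma(T)=F_{\sigma(T)}(T)$, defined whenever $T-\sigma(T)I$ is almost invertible. Invariance of a set under $F_\sigma$ means that $F_\sigma$ is defined on it and maps it into itself. A simple shift strategy is a function $\sigma:\mathcal{T}_\Lambda\to\mathbb{R}$ with $\sigma(ETE)=\sigma(T)$ for all $T$ and all $E\in\mathcal{E}$, for which there exists $C_\sigma>0$ such that for every $T\in\mathcal{T}_\Lambda$ there is an index $i$ with $|\sigma(T)-\lambda_i|\le C_\sigma|b(T)|$ and $|(T)_{n,n}-\lambda_i|\le\sqrt2\,|b(T)|$. No continuity of $\sigma$ is assumed. The singular support $\mathcal{S}_\sigma\subset\mathcal{T}_\Lambda$ is the smallest closed set on whose complement $\sigma$ is smooth. *)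

(* Defs.v *)
From HB Require Import structures.
From mathcomp Require Import all_boot all_order all_algebra.
From mathcomp Require Import all_classical all_reals all_analysis.

Set Implicit Arguments.
Unset Strict Implicit.
Unset Printing Implicit Defensive.

Import Order.TTheory GRing.Theory Num.Theory.
Import numFieldNormedType.Exports.

Local Open Scope classical_set_scope.
Local Open Scope ring_scope.

Section Spectrum.
Variables (R : realType) (n : nat).
Implicit Types (A : 'M[R]_n) (lam : 'rV[R]_n).

Definition increasing lam : Prop :=
  forall i j : 'I_n, (i < j)%N -> lam 0 i < lam 0 j.

Definition has_spectrum A lam : Prop :=
  forall a : R, eigenvalue A a <-> exists i, a = lam 0 i.

(* An n x n matrix with n distinct eigenvalues: they are then all simple. *)
Definition simple_spectrum A lam : Prop :=
  increasing lam /\ has_spectrum A lam.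

Definition ap A : Prop := exists lam, simple_spectrum A lam /\
  exists i j k : 'I_n, [/\ (i < j)%N, (j < k)%N &
    lam 0 j - lam 0 i = lam 0 k - lam 0 j].

Definition strong_ap A : Prop := exists lam, simple_spectrum A lam /\
  exists i j k : 'I_n, [/\ j = i.+1 :> nat, k = j.+1 :> nat &
    lam 0 j - lam 0 i = lam 0 k - lam 0 j].

Definition weak_ap A : Prop := ap A /\ ~ strong_ap A.

Definition tridiagonal A : Prop :=
  forall i j : 'I_n, (i.+1 < j)%N || (j.+1 < i)%N -> A i j = 0.

Definition unreduced A : Prop :=
  forall i j : 'I_n, i = j.+1 :> nat -> A i j != 0.

Definition isospectral lam : set 'M[R]_n :=
  [set T | [/\ T^T = T, tridiagonal T & has_spectrum T lam]].

Definition sign_diagonal A : Prop := exists e : 'rV[R]_n,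
  (forall i, e 0 i = 1 \/ e 0 i = -1) /\ A = diag_mx e.

End Spectrum.

Section Smoothness.
Variables (R : realType) (V : normedModType R).

(* f is of class C^k on the open set U. *)
Fixpoint classC (k : nat) (U : set V) (f : V -> R) : Prop :=
  match k with
  | 0 => forall x, U x -> {for x, continuous f}
  | k'.+1 => (forall x, U x -> differentiable f x) /\
             (forall v : V, classC k' U (fun x => 'D_v f x))
  end.

(* Smoothness of a function on a subset X of V: local extension to a C^oo
   function on an open subset of V.  When X is an embedded submanifold (such
   as a relatively open subset of an isospectral manifold of tridiagonal
   matrices) this is smoothness in the charts of X.  The values of f outside
   X are irrelevant. *)
Definition smooth_on (X : set V) (f : V -> R) : Prop :=
  forall x, X x -> exists (U : set V) (g : V -> R),
    [/\ open U, U x, forall k, classC k U g &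
        forall y, U y -> X y -> g y = f y].

End Smoothness.

Section Step.
Variables (R : realType) (n : nat).
Implicit Types (M Q T : 'M[R]_n.+1) (sigma : 'M[R]_n.+1 -> R).

Definition almost_invertible M : Prop := row_free (col' ord_max M)^T.

Definition special_orthogonal Q : Prop := Q^T *m Q = 1%:M /\ \det Q = 1.

Definition QR_star M Q (U : 'M[R]_n.+1) : Prop :=
  [/\ M = Q *m U, special_orthogonal Q,
      forall i j : 'I_n.+1, (j < i)%N -> U i j = 0 &
      forall i : 'I_n.+1, (i < n)%N -> 0 < U i i].

(* The unique such factor when M is almost invertible; a dummy value, 1,
   otherwise. *)
Definition Q_star M : 'M[R]_n.+1 :=
  xget 1%:M [set Q | exists U, QR_star M Q U].

Definition step (s : R) T : 'M[R]_n.+1 :=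
  let Q := Q_star (T - s%:M) in Q^T *m T *m Q.

Definition shifted_step sigma T : 'M[R]_n.+1 := step (sigma T) T.

Definition step_defined sigma T : Prop :=
  almost_invertible (T - (sigma T)%:M).

Definition invariant_under sigma (D : set 'M[R]_n.+1) : Prop :=
  forall T, D T -> step_defined sigma T /\ D (shifted_step sigma T).

End Step.

(* Sizes are written n.+3: an a.p. matrix has at least three eigenvalues. *)
Section ShiftStrategy.
Variables (R : realType) (n : nat).
Implicit Types (T : 'M[R]_n.+3) (lam : 'rV[R]_n.+3) (sigma : 'M[R]_n.+3 -> R).

Definition subdiag_last T : R := T ord_max (inord n.+1).

Definition deflation lam (eps : R) : set 'M[R]_n.+3 :=
  [set T | isospectral lam T /\ `|subdiag_last T| <= eps].

Definition double_deflation lam : set 'M[R]_n.+3 :=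
  [set T | [/\ isospectral lam T, subdiag_last T = 0 &
               T (inord n.+1) (inord n) = 0]].

(* Only the restriction of sigma to isospectral lam is constrained. *)
Definition simple_shift lam sigma : Prop :=
  (forall T E, isospectral lam T -> sign_diagonal E ->
     sigma (E *m T *m E) = sigma T) /\
  exists C : R, 0 < C /\ forall T, isospectral lam T ->
    exists i, `|sigma T - lam 0 i| <= C * `|subdiag_last T| /\
              `|T ord_max ord_max - lam 0 i| <= Num.sqrt 2 * `|subdiag_last T|.

(* The ambient closed subsets of isospectral lam are its relatively closed
   subsets, because it is compact. *)
Definition singular_support lam sigma : set 'M[R]_n.+3 :=
  \bigcap_(S in [set S | [/\ closed S, S `<=` isospectral lam &
                 smooth_on (isospectral lam `\` S) sigma]]) S.

End ShiftStrategy.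

(* Main.v *)
Require Import Defs.
From mathcomp Require Import all_boot all_order all_algebra.
From mathcomp Require Import all_classical all_reals all_analysis.
From mathcomp Require Import ring lra zify.

(** Everything is read off from the eigenvectors.  Let [V] be an orthogonal
    matrix with [T V = V diag lam], let [w_j] be the last component of the
    [j]-th eigenvector and [b] the last subdiagonal entry of [T].  The last row
    of [T V = V diag lam] shows that the weights [w_j ^+ 2] placed at the
    eigenvalues have mean [T n n] and variance [b ^+ 2]
    ([last_row_moment]), and a step with shift [s] turns [w_j] into a common
    multiple of [w_j / (lam_j - s)] ([conj_last_row]).  So when [b] is small
    nearly all the weight is at one eigenvalue [lam_i], this index persists
    along the orbit, and the new [b] is at most a constant times
    [|s - lam_i| * |b|] ([step_contraction], [deflating_step]).  Since
    [|s - lam_i| <= C * |b|], this gives the invariance of a deflation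
    neighborhood and the convergence of [b] to zero, and the rate is cubic as
    soon as [|s - lam_i|] is [O(b ^+ 2)].

    Two facts yield this last bound along the orbit of an unreduced matrix.

    Firstly, the orbit accumulates only at doubly deflated matrices.  Without
    three consecutive eigenvalues in arithmetic progression there is a unique
    eigenvalue [lam_m] closest to [lam_i] ([closest_eigenvalue]); as [s] tends
    to [lam_i], the ratios [w_j / w_m] tend to zero for the other [j]
    ([weight_ratio_cvg0]).  The penultimate row of [V] has entries
    [(lam_j - T n n) * w_j / b], hence tends to the [m]-th coordinate vector up
    to sign, and in the limit the last two couplings vanish
    ([orbit_limit_double_deflation]).

    Secondly, near a doubly deflated matrix [T0] outside of the singular support
    the error of the shift is quadratic ([quadratic_shift]).  Let [E] be
    the sign matrix changing the last coordinate.  The shift is the same at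
    [T] and [E T E], two points symmetric about the matrix [M] obtained from [T]
    by erasing [b], so a smooth extension of the shift differs by
    [O(b ^+ 2)] between [T] and [M] ([even_second_order]).  In general [M] does
    not have the right spectrum, but an isospectral [T1] with vanishing [b] lies
    within [O(b ^+ 2)] of it ([retraction]), and at [T1] the shift is exactly
    [lam_i].  This [T1] is [Q^T T Q], where [Q] is the orthogonal factor of the
    projection onto the complement of the [i]-th eigenvector: one step that
    deflates at once, with [Q] close to the identity. *)

Import Order.TTheory GRing.Theory Num.Theory.
Import numFieldNormedType.Exports.

Set Implicit Arguments.
Unset Strict Implicit.
Unset Printing Implicit Defensive.

Local Open Scope classical_set_scope.
Local Open Scope ring_scope.

(** * Orthonormal eigenbases *)

Section Eigenframe.
Variables (R : realType) (n : nat).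
Implicit Types (T V Q : 'M[R]_n) (lam : 'rV[R]_n).

Definition eigenframe lam T V : Prop :=
  V^T *m V = 1%:M /\ T *m V = V *m diag_mx lam.

Lemma increasing_inj lam (i j : 'I_n) :
  increasing lam -> lam 0 i = lam 0 j -> i = j.
Proof.
move=> incr lamE; case: (ltngtP i j) => [ij|ji|/val_inj //].
- by have := incr _ _ ij; rewrite lamE ltxx.
- by have := incr _ _ ji; rewrite lamE ltxx.
Qed.

Lemma row_norm_gt0 (v : 'rV[R]_n) : v != 0 -> 0 < (v *m v^T) 0 0.
Proof.
move=> v0; rewrite mxE lt_neqAle eq_sym sumr_ge0 ?andbT; last first.
  by move=> j _; rewrite mxE -expr2 sqr_ge0.
apply: contra v0 => /eqP/psumr_eq0P s0; apply/eqP/matrixP => a j.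
rewrite ord1 [RHS]mxE; have := s0 _ j isT; rewrite mxE => /(_ _)/eqP.
rewrite mulf_eq0 orbb => h; apply/eqP/h => k _.
by rewrite mxE -expr2 sqr_ge0.
Qed.

(** Eigenvectors of a symmetric matrix for distinct eigenvalues are
    orthogonal; one normalized eigenvector for each of the [n] distinct
    eigenvalues therefore makes up an orthonormal basis. *)
Lemma eigenframe_exists lam T :
  increasing lam -> T^T = T -> has_spectrum T lam ->
  exists V, eigenframe lam T V.
Proof.
move=> incr symT specT.
have /choice[v vP] : forall j : 'I_n, exists v : 'rV[R]_n,
    v *m T = lam 0 j *: v /\ v != 0.
  move=> j; have /eigenvalueP[v] : eigenvalue T (lam 0 j).
    by apply/specT; exists j.
  by exists v.
(* the inverse norm of the chosen eigenvector *)
pose c j := (Num.sqrt ((v j *m (v j)^T) 0 0))^-1.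
pose W := \matrix_j (c j *: v j).
have rowW j : row j W = c j *: v j by rewrite rowK.
have WW : W *m W^T = 1%:M.
  apply/matrixP => j k.
  have -> : (W *m W^T) j k = c j * c k * (v j *m (v k)^T) 0 0.
    rewrite mxE [in RHS]mxE mulr_sumr; apply: eq_bigr => l _.
    by rewrite !mxE mulrACA.
  rewrite [RHS]mxE; have [<-|jk] := eqVneq j k.
    have vv := row_norm_gt0 (vP j).2.
    rewrite /c -invfM -expr2 sqr_sqrtr ?(ltW vv) // mulVf ?gt_eqF //.
  have : (lam 0 j - lam 0 k) * (v j *m (v k)^T) 0 0 = 0.
    have e1 : v j *m T *m (v k)^T = lam 0 j *: (v j *m (v k)^T).
      by rewrite (vP j).1 scalemxAl.
    have e2 : v j *m T *m (v k)^T = lam 0 k *: (v j *m (v k)^T).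
      have eT : T *m (v k)^T = lam 0 k *: (v k)^T.
        by rewrite -[T]symT -trmx_mul (vP k).1 linearZ.
      by rewrite -mulmxA eT scalemxAr.
    move: e2; rewrite e1 => /matrixP/(_ 0 0).
    by rewrite [LHS]mxE [RHS]mxE mulrBl => ->; rewrite subrr.
  move/eqP; rewrite mulf_eq0 subr_eq0 => /orP[/eqP/(increasing_inj incr)|/eqP ->].
    by move=> e; rewrite e eqxx in jk.
  by rewrite mulr0.
have WT : W *m T = diag_mx lam *m W.
  apply/row_matrixP => j.
  rewrite row_mul rowW -scalemxAl (vP j).1 row_mul row_diag_mx -scalemxAl -rowE.
  by rewrite rowW !scalerA mulrC.
exists W^T; split; first by rewrite trmxK.
by rewrite -{1}symT -trmx_mul WT trmx_mul tr_diag_mx.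
Qed.

Lemma orthogonalC V : V^T *m V = 1%:M -> V *m V^T = 1%:M.
Proof. exact: mulmx1C. Qed.

Lemma eigenframeE lam T V :
  eigenframe lam T V -> T = V *m diag_mx lam *m V^T.
Proof. by case=> orthV <-; rewrite -mulmxA (orthogonalC orthV) mulmx1. Qed.

Lemma eigenframe_sym lam T V : eigenframe lam T V -> T^T = T.
Proof.
by move=> /eigenframeE ->; rewrite !trmx_mul trmxK tr_diag_mx mulmxA.
Qed.

Lemma eigenframe_spectrum lam T V : eigenframe lam T V -> has_spectrum T lam.
Proof.
move=> frV; have [orthV TV] := frV; have orthV' := orthogonalC orthV.
move=> a; split=> [/eigenvalueP[v vT v0]|[j ->]].
  have vV0 : v *m V != 0.
    apply: contra v0 => /eqP vV.
    by rewrite -[v]mulmx1 -orthV' mulmxA vV mul0mx.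
  have [j vVj] : exists j, (v *m V) 0 j != 0.
    apply/existsP; apply: contraNT vV0 => /existsPn vV0; apply/eqP/matrixP => i j.
    by rewrite ord1 [RHS]mxE; apply/eqP; rewrite -[_ == _]negbK vV0.
  exists j; apply: (mulIf vVj).
  have : v *m V *m diag_mx lam = a *: (v *m V).
    by rewrite -mulmxA -TV mulmxA vT scalemxAl.
  move/matrixP/(_ 0 j); rewrite mul_mx_diag mxE [RHS]mxE => <-.
  by rewrite mulrC.
apply/eigenvalueP; exists (row j V^T).
  rewrite -row_mul (eigenframeE frV) !mulmxA orthV mul1mx.
  by rewrite row_mul row_diag_mx -scalemxAl -rowE.
apply/eqP => e; have : (V^T *m V) j j = 0.
  by have := row_mul j V^T V; rewrite e mul0mx => /matrixP/(_ 0 j); rewrite [LHS]mxE [RHS]mxE.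
by rewrite orthV mxE eqxx => /eqP; rewrite oner_eq0.
Qed.

Lemma orthogonal_row V (j k : 'I_n) : V^T *m V = 1%:M ->
  \sum_l V j l * V k l = (j == k)%:R.
Proof.
move=> /orthogonalC/matrixP/(_ j k); rewrite !mxE => <-.
by apply: eq_bigr => l _; rewrite mxE.
Qed.

Lemma orthogonal_col V (j k : 'I_n) : V^T *m V = 1%:M ->
  \sum_l V l j * V l k = (j == k)%:R.
Proof.
move=> /matrixP/(_ j k); rewrite !mxE => <-.
by apply: eq_bigr => l _; rewrite mxE.
Qed.

Lemma orthogonal_row2 V (j : 'I_n) : V^T *m V = 1%:M ->
  \sum_l V j l ^+ 2 = 1.
Proof. by move=> /orthogonal_row => /(_ j j); rewrite eqxx. Qed.

Lemma orthogonal_col2 V (j : 'I_n) : V^T *m V = 1%:M ->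
  \sum_l V l j ^+ 2 = 1.
Proof. by move=> /orthogonal_col => /(_ j j); rewrite eqxx. Qed.

Lemma orthogonal_entry_le1 V (j k : 'I_n) : V^T *m V = 1%:M -> `|V j k| <= 1.
Proof.
move=> orthV; rewrite -(@ler_pXn2r _ 2) ?nnegrE // expr1n.
rewrite -(orthogonal_row2 j orthV) (bigD1 k) //= real_normK ?num_real //.
by rewrite lerDl sumr_ge0 // => l _; rewrite sqr_ge0.
Qed.

(** Right multiplication by the orthogonal [V] preserves the norm of row [r]
    of [T - mu], and turns it into row [r] of [V (diag lam - mu)]. *)
Lemma shifted_row_norm lam T V (r : 'I_n) mu : eigenframe lam T V ->
  \sum_k (T - mu%:M) r k ^+ 2 = \sum_j V r j ^+ 2 * (lam 0 j - mu) ^+ 2.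
Proof.
move=> [orthV TV]; have orthV' := orthogonalC orthV.
set M := T - mu%:M.
have MV j : (M *m V) r j = V r j * (lam 0 j - mu).
  by rewrite mulmxBl TV mul_mx_diag mul_scalar_mx !mxE mulrBr mulrC [mu * _]mulrC mulrC.
transitivity ((M *m V *m (M *m V)^T) r r).
  rewrite trmx_mul mulmxA -(mulmxA M) orthV' mulmx1 mxE.
  by apply: eq_bigr => k _; rewrite !mxE expr2.
rewrite mxE; apply: eq_bigr => j _.
by rewrite [(M *m V)^T _ _]mxE MV -expr2 exprMn.
Qed.

End Eigenframe.

(** * QR factorizations with at most one vanishing pivot *)

Section Householder.
Variable R : realType.

(** The reflection exchanging [m] and the multiple [a] of the first coordinate
    vector that has the same norm: its mirror is orthogonal to their
    difference [u]. *)
Lemma reflection_exists n (m : 'cV[R]_n.+1) :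
  exists (H : 'M[R]_n.+1) (a : R),
    [/\ H^T *m H = 1%:M, 0 <= a & H *m m = a *: delta_mx 0 0].
Proof.
pose a := Num.sqrt ((m^T *m m) 0 0).
pose e : 'cV[R]_n.+1 := delta_mx 0 0.
have dotC (x y : 'cV[R]_n.+1) : x^T *m y = y^T *m x.
  by apply/matrixP => i j; rewrite !ord1 !mxE; apply: eq_bigr => k _; rewrite !mxE mulrC.
have mm : m^T *m m = (a ^+ 2)%:M.
  rewrite [LHS]mx11_scalar sqr_sqrtr // mxE sumr_ge0 // => k _.
  by rewrite mxE -expr2 sqr_ge0.
have ee : e^T *m e = 1%:M.
  by rewrite trmx_delta mul_delta_mx; apply/matrixP => i j; rewrite !ord1 !mxE.
pose u := m - a *: e.
have [u0|u0] := eqVneq u 0.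
  exists 1%:M, a; split; rewrite ?sqrtr_ge0 ?trmx1 ?mulmx1 ?mul1mx //.
  by apply/eqP; rewrite -subr_eq0 -/e -/u u0.
have uT : u^T = m^T - a *: e^T by rewrite /u linearB linearZ.
pose d := (u^T *m u) 0 0.
have uu : u^T *m u = d%:M by rewrite [LHS]mx11_scalar.
have d0 : d != 0.
  have := @row_norm_gt0 _ _ u^T; rewrite trmxK -/d => h.
  by rewrite gt_eqF // h // -trmx0 (inj_eq trmx_inj).
have um : u^T *m m = (d / 2)%:M.
  (* |u|^2 = 2 (|m|^2 - a m_0), because |m| = a *)
  have -> : d / 2 = a ^+ 2 - a * (e^T *m m) 0 0.
    have /(congr1 (fun A : 'M[R]_1 => A 0 0)) : u^T *m u =
        (a ^+ 2 *+ 2 - (a * (e^T *m m) 0 0) *+ 2)%:M.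
      rewrite uT /u mulmxBl !mulmxBr -!scalemxAl -!scalemxAr.
      rewrite mm ee (dotC m e) [e^T *m m]mx11_scalar.
      by apply/matrixP => i j; rewrite !ord1 !mxE /= mulr1n; ring.
    by rewrite uu [LHS]mxE [RHS]mxE !mulr1n => ->; field.
  rewrite uT mulmxBl -scalemxAl mm [e^T *m m]mx11_scalar.
  by apply/matrixP => i j; rewrite !ord1 !mxE /= !mulr1n.
have dd : 2 / d * (d / 2) = 1 by field.
have symH : (1%:M - (2 / d) *: (u *m u^T))^T = 1%:M - (2 / d) *: (u *m u^T).
  by rewrite linearB linearZ /= trmx1 trmx_mul trmxK.
exists (1%:M - (2 / d) *: (u *m u^T)), a; split; [|exact: sqrtr_ge0|].
  rewrite symH mulmxBl !mulmxBr !mul1mx mulmx1 -scalemxAr -!scalemxAl.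
  rewrite -mulmxA (mulmxA u^T) uu mul_scalar_mx -scalemxAr !scalerA.
  have -> : 2 / d * (2 / d) * d = 2 / d + 2 / d by field.
  by rewrite scalerDl opprB; apply/matrixP=> i j; rewrite !mxE; ring.
rewrite mulmxBl mul1mx -scalemxAl -mulmxA um mul_mx_scalar scalerA dd.
by rewrite scale1r /u opprB addrC subrK.
Qed.

(** A reflection clears the first column below the diagonal; recursion on the
    lower right block. *)
Lemma QR_exists n (M : 'M[R]_n) : exists Q U,
  [/\ M = Q *m U, Q^T *m Q = 1%:M, forall i j : 'I_n, (j < i)%N -> U i j = 0 &
      forall i, 0 <= U i i].
Proof.
elim: n M => [|n IHn] M.
  by exists 1%:M, M; split; rewrite ?mul1mx ?trmx1 ?mul1mx // => -[].
have [H [a [orthH a0 Hm]]] := reflection_exists (col 0 M).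
pose N : 'M[R]_(1 + n) := H *m M.
have [Q [U [NE orthQ upU U0]]] := IHn (drsubmx N).
pose B : 'M[R]_(1 + n) := block_mx 1 0 0 Q.
pose W : 'M[R]_(1 + n) := block_mx a%:M (ursubmx N) 0 U.
have NW : N = B *m W.
  rewrite /B /W mulmx_block !mul0mx !mulmx0 !mul1mx !addr0 !add0r -NE.
  rewrite -[LHS]submxK; congr block_mx.
    apply/matrixP => i j; rewrite !ord1 !mxE /=.
    have /matrixP/(_ 0 0) := Hm; rewrite !mxE /= mulr1 mulr1n => <-.
    by apply: eq_bigr => k _; rewrite !mxE; congr (H _ _ * M _ _); apply: val_inj.
  apply/matrixP => i j; rewrite !ord1 !mxE /=.
  have /matrixP/(_ (rshift 1 i) 0) := Hm; rewrite !mxE /= mulr0 => Hm0.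
  rewrite -[RHS]Hm0.
  by apply: eq_bigr => k _; rewrite !mxE; congr (H _ _ * M _ _); apply: val_inj.
have orthB : B^T *m B = 1%:M.
  rewrite /B tr_block_mx mulmx_block !trmx0 !mul0mx !mulmx0 orthQ trmx1 mul1mx.
  by rewrite !addr0 !add0r -scalar_mx_block.
exists (H^T *m B), W; split.
- by rewrite -mulmxA -NW /N mulmxA orthH mul1mx.
- by rewrite trmx_mul trmxK mulmxA -(mulmxA B^T) (orthogonalC orthH) mulmx1.
- move=> i j; rewrite /W; case: (@split_ordP 1 n i) => i' ->; case: (@split_ordP 1 n j) => j' ->.
  + by rewrite !ord1.
  + by rewrite !ord1 /=.
  + by move=> _; rewrite (@block_mxEdl _ 1 n 1 n) mxE.
  + by rewrite (@block_mxEdr _ 1 n 1 n) => /upU.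
- move=> i; rewrite /W; case: (@split_ordP 1 n i) => i' ->.
  + by rewrite (@block_mxEul _ 1 n 1 n) mxE !ord1.
  + by rewrite (@block_mxEdr _ 1 n 1 n).
Qed.

End Householder.

Section LastSign.
Variables (R : realType) (n : nat).
Implicit Types (M Q U T : 'M[R]_n.+1).

Definition last_sign (e : R) : 'M[R]_n.+1 :=
  diag_mx (\row_j if j == ord_max then e else 1).

Lemma tr_last_sign e : (last_sign e)^T = last_sign e.
Proof. exact: tr_diag_mx. Qed.

Lemma last_signK e : e * e = 1 -> last_sign e *m last_sign e = 1%:M.
Proof.
move=> ee; rewrite mulmx_diag -diag_const_mx; congr diag_mx.
by apply/matrixP => i j; rewrite !mxE; case: ifP => _; rewrite ?ee ?mulr1.
Qed.

Lemma det_last_sign e : \det (last_sign e) = e.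
Proof.
rewrite det_diag (bigD1 ord_max) //= mxE eqxx big1 ?mulr1 // => i ni.
by rewrite mxE (negbTE ni).
Qed.

Lemma mul_last_sign e M i j :
  (last_sign e *m M) i j = (if i == ord_max then e else 1) * M i j.
Proof. by rewrite mul_diag_mx !mxE. Qed.

Lemma mulr_last_sign e M i j :
  (M *m last_sign e) i j = M i j * (if j == ord_max then e else 1).
Proof. by rewrite mul_mx_diag !mxE. Qed.

(** The conditions of [QR_star] without the orientation of [Q]: the sign of
    the last column of [Q] is free. *)
Definition QR_factors M Q U : Prop :=
  [/\ M = Q *m U, Q^T *m Q = 1%:M, forall i j : 'I_n.+1, (j < i)%N -> U i j = 0 &
      forall i : 'I_n.+1, (i < n)%N -> 0 < U i i].

Lemma QR_factors_flip e M Q U : e * e = 1 -> QR_factors M Q U ->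
  QR_factors M (Q *m last_sign e) (last_sign e *m U).
Proof.
move=> ee [ME orthQ upU posU]; split.
- by rewrite mulmxA -(mulmxA Q) last_signK // mulmx1.
- by rewrite trmx_mul tr_last_sign mulmxA -(mulmxA _ Q^T) orthQ mulmx1 last_signK.
- by move=> i j ji; rewrite mul_last_sign upU // mulr0.
- move=> i ni; rewrite mul_last_sign ifF ?mul1r ?posU //.
  by apply/negbTE; rewrite -val_eqE /= neq_ltn ni.
Qed.

(** If a diagonal entry [U i i] with [i < n] vanished, the leading block of
    [U] would be singular, and so the first columns of [M = Q U] dependent. *)
Lemma QR_factors_exists M : almost_invertible M -> exists Q U, QR_factors M Q U.
Proof.
move=> aiM; have [Q [U [ME orthQ upU U0]]] := QR_exists M.
exists Q, U; split=> // i ni; rewrite lt_neqAle U0 andbT eq_sym; apply/negP => /eqP Uii.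
pose U' := row' ord_max (col' ord_max U).
have detU' : \det U'^T == 0.
  rewrite det_trig; last first.
    apply/is_trig_mxP => k l kl; rewrite !mxE upU //.
    by rewrite (lift_max k) (lift_max l).
  apply/eqP; apply/eqP/prodf_eq0; exists (Ordinal ni) => //.
  rewrite !mxE; suff -> : lift ord_max (Ordinal ni) = i by rewrite Uii.
  by apply: val_inj; exact: (lift_max (Ordinal ni)).
have [x x0 xU] := det0P detU'.
case/negP: x0; rewrite -(mulmx_free_eq0 _ aiM).
have -> : col' ord_max M = Q *m col' ord_max U.
  by rewrite ME; apply/matrixP => k l; rewrite !mxE; apply: eq_bigr => s _; rewrite !mxE.
rewrite trmx_mul mulmxA; suff -> : x *m (col' ord_max U)^T = 0 by rewrite mul0mx.
apply/matrixP => k l; rewrite [RHS]mxE; case: (unliftP ord_max l) => [l' ->|->].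
  move/matrixP/(_ k l') : xU; rewrite !mxE => xU; rewrite -[RHS]xU.
  by apply: eq_bigr => s _; rewrite !mxE.
rewrite mxE big1 // => s _; rewrite !mxE upU ?mulr0 //.
by rewrite lift_max /=.
Qed.

Lemma orthogonal_det Q : Q^T *m Q = 1%:M -> \det Q * \det Q = 1.
Proof. by move=> orthQ; rewrite -{1}det_tr -det_mulmx orthQ det1. Qed.

Lemma Q_star_spec M : almost_invertible M -> exists U, QR_factors M (Q_star M) U.
Proof.
move=> aiM; have [Q [U QU]] := QR_factors_exists aiM.
have orthQ : Q^T *m Q = 1%:M by case: QU.
have dd := orthogonal_det orthQ.
have [ME' orthQ' upU' posU'] := QR_factors_flip dd QU.
suff: [set Q | exists U, QR_star M Q U] (Q_star M).
  by move=> [U1 [E1 [orth1 _] up1 pos1]]; exists U1; split.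
apply: (xgetPex 1%:M); exists (Q *m last_sign (\det Q)), (last_sign (\det Q) *m U).
by split=> //; split=> //; rewrite det_mulmx det_last_sign.
Qed.

(** With [F = Q^T T Q] one has [F U = U T]. The first [n] pivots of [U] do not
    vanish, so the zeros below the subdiagonal of [T] pass, column after
    column, to [F]; the last column of a Hessenberg matrix is unconstrained,
    which is why the last pivot may vanish. *)
Lemma conj_tridiagonal M T Q U : T^T = T -> tridiagonal T ->
  M *m T = T *m M -> QR_factors M Q U -> tridiagonal (Q^T *m T *m Q).
Proof.
move=> symT triT comm [ME orthQ upU posU].
set F := Q^T *m T *m Q.
have symF : F^T = F by rewrite /F !trmx_mul trmxK symT mulmxA.
have FU : F *m U = U *m T.
  by rewrite /F -!mulmxA -ME -comm ME !mulmxA orthQ mul1mx.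
suff hess (j i : 'I_n.+1) : (j.+1 < i)%N -> F i j = 0.
  move=> i j /orP[ij|ji]; last exact: hess.
  by rewrite -symF mxE hess.
have [k] := ubnP (val j); elim: k j i => // k IHk j i jk ji.
have jn : (j < n)%N by rewrite ltnW // (leq_trans ji) // -ltnS.
have : (F *m U) i j = F i j * U j j.
  rewrite mxE (bigD1 j) //= big1 ?addr0 // => l lj.
  case: (ltngtP l j) => [l_j|j_l|/val_inj e]; last by rewrite e eqxx in lj.
  - rewrite IHk ?mul0r //; first by rewrite (leq_trans l_j).
    by rewrite (leq_ltn_trans _ ji) // ltnS ltnW.
  - by rewrite upU ?mulr0.
rewrite FU mxE big1 => [/esym/eqP|l _].
  by rewrite mulf_eq0 (gt_eqF (posU _ jn)) orbF => /eqP.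
have [li|il] := ltnP l i; first by rewrite upU ?mul0r.
by rewrite triT ?mulr0 // (leq_trans ji il) orbT.
Qed.

Lemma conj_eigenframe lam T V Q : Q^T *m Q = 1%:M -> eigenframe lam T V ->
  eigenframe lam (Q^T *m T *m Q) (Q^T *m V).
Proof.
move=> orthQ [orthV TV]; have orthQ' := orthogonalC orthQ; split.
  by rewrite trmx_mul trmxK mulmxA -(mulmxA V^T) orthQ' mulmx1.
by rewrite -!mulmxA (mulmxA Q) orthQ' mul1mx TV !mulmxA.
Qed.

(** Since [U] is upper triangular, its last row is [U n n] times the last
    coordinate row: the last row of [Q^T M = U], read in the eigenbasis. *)
Lemma conj_last_row (mu : 'rV[R]_n.+1) M V Q U :
  M *m V = V *m diag_mx mu -> QR_factors M Q U ->
  forall j, mu 0 j * (Q^T *m V) ord_max j = U ord_max ord_max * V ord_max j.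
Proof.
move=> MV [ME orthQ upU _] j.
have : (Q^T *m M *m V) ord_max j = (U *m V) ord_max j.
  by rewrite ME mulmxA orthQ mul1mx.
rewrite -mulmxA MV mulmxA mul_mx_diag mxE mulrC => ->.
rewrite mxE (bigD1 ord_max) //= big1 ?addr0 // => k kn.
by rewrite upU ?mul0r // ltn_neqAle -ltnS ltn_ord andbT.
Qed.

End LastSign.

(** * Last components of the eigenvectors *)

Section LastRow.
Variables (R : realType) (n : nat).
Implicit Types (T V Q U : 'M[R]_n.+3) (lam : 'rV[R]_n.+3).

Local Notation pen := (inord n.+1 : 'I_n.+3).
Local Notation ante := (inord n : 'I_n.+3).

Lemma val_pen : (pen : nat) = n.+1. Proof. by rewrite inordK. Qed.
Lemma val_ante : (ante : nat) = n. Proof. by rewrite inordK // ltnS leqW. Qed.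

Lemma pen_neq_max : pen != ord_max.
Proof. by rewrite -val_eqE /= val_pen neq_ltn ltnSn. Qed.

Lemma ante_neq_pen : ante != pen.
Proof. by rewrite -val_eqE /= val_pen val_ante neq_ltn ltnSn. Qed.

Lemma tridiagonal_last T (k : 'I_n.+3) :
  tridiagonal T -> k != ord_max -> k != pen -> T ord_max k = 0.
Proof.
move=> triT; rewrite -!val_eqE /= val_pen => k1 k2; apply: triT.
by apply/orP; right; have := ltn_ord k; move: k1 k2 => /=; lia.
Qed.

Lemma sum_last T (f : 'I_n.+3 -> R) : tridiagonal T ->
  \sum_k T ord_max k * f k = T ord_max ord_max * f ord_max + subdiag_last T * f pen.
Proof.
move=> triT; rewrite (bigD1 ord_max) //= (bigD1 pen) ?pen_neq_max //=.
by rewrite big1 ?addr0 // => k /andP[k1 k2]; rewrite tridiagonal_last ?mul0r.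
Qed.

(** The second moment about [mu] of the weights [V ord_max j ^+ 2] placed at
    the eigenvalues: this is how [b(T)] is read off from the eigenvectors. *)
Lemma last_row_moment lam T V mu : tridiagonal T -> eigenframe lam T V ->
  (T ord_max ord_max - mu) ^+ 2 + subdiag_last T ^+ 2 =
  \sum_j V ord_max j ^+ 2 * (lam 0 j - mu) ^+ 2.
Proof.
move=> triT frV; rewrite -(shifted_row_norm _ _ frV).
rewrite (bigD1 ord_max) //= (bigD1 pen) ?pen_neq_max //=.
rewrite big1 ?addr0 => [|k /andP[k1 k2]].
  rewrite /subdiag_last !mxE eqxx [ord_max == pen]eq_sym (negbTE pen_neq_max).
  by rewrite mulr1n oppr0 addr0.
rewrite !mxE tridiagonal_last // [ord_max == k]eq_sym (negbTE k1) /=.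
by rewrite oppr0 addr0 expr0n.
Qed.

Section Gap.
Variables (lam : 'rV[R]_n.+3) (gap : R).
Hypothesis gap_gt0 : 0 < gap.
Hypothesis gapP : forall i j, i != j -> gap <= `|lam 0 i - lam 0 j|.

(** In the moment about [lam i], every weight other than the [i]-th one is at
    distance at least [gap]. *)
Lemma last_weight_defect T V i : tridiagonal T -> eigenframe lam T V ->
  (1 - V ord_max i ^+ 2) * gap ^+ 2 <=
  (T ord_max ord_max - lam 0 i) ^+ 2 + subdiag_last T ^+ 2.
Proof.
move=> triT frV; rewrite (last_row_moment _ triT frV).
rewrite -(orthogonal_row2 ord_max frV.1) (bigD1 i) //= addrAC subrr add0r.
rewrite [leRHS](bigD1 i) //= subrr expr0n mulr0 add0r mulr_suml.
apply: ler_sum => j ji; rewrite ler_wpM2l ?sqr_ge0 //.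
by rewrite -[leRHS]real_normK ?num_real // ler_pXn2r ?nnegrE ?(ltW gap_gt0) ?gapP.
Qed.

(** With [c] the last diagonal entry, the moments about [lam i] and about its
    mirror image [2 c - lam i] both equal [(c - lam i) ^+ 2 + b ^+ 2]; in the
    second one the [i]-th weight alone contributes at least
    [2 (c - lam i) ^+ 2]. *)
Lemma diag_last_error T V i : tridiagonal T -> eigenframe lam T V ->
  2^-1 <= V ord_max i ^+ 2 ->
  (T ord_max ord_max - lam 0 i) ^+ 2 <= subdiag_last T ^+ 2.
Proof.
move=> triT frV pi; set c := T ord_max ord_max.
have := last_row_moment (2 * c - lam 0 i) triT frV; rewrite -/c => E.
have : V ord_max i ^+ 2 * (lam 0 i - (2 * c - lam 0 i)) ^+ 2 <=
    (c - (2 * c - lam 0 i)) ^+ 2 + subdiag_last T ^+ 2.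
  by rewrite E (bigD1 i) //= lerDl sumr_ge0 // => j _; rewrite mulr_ge0 ?sqr_ge0.
by have := ler_wpM2r (sqr_ge0 (2 * (c - lam 0 i))) pi; lra.
Qed.

(** The new weights are proportional to [w_j / (lam_j - s)], by
    [conj_last_row]; all but the [i]-th become small with [s - lam_i]. *)
Lemma step_contraction T V Q U s i : tridiagonal T -> eigenframe lam T V ->
  QR_factors (T - s%:M) Q U -> tridiagonal (Q^T *m T *m Q) ->
  2^-1 <= V ord_max i ^+ 2 -> `|lam 0 i - s| <= gap / 2 ->
  ((Q^T *m T *m Q) ord_max ord_max - lam 0 i) ^+ 2 +
    subdiag_last (Q^T *m T *m Q) ^+ 2 <=
  16 / gap ^+ 2 * (lam 0 i - s) ^+ 2 * subdiag_last T ^+ 2.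
Proof.
move=> triT frV QU triF pi si; have [_ orthQ _ _] := QU.
have frF := conj_eigenframe orthQ frV.
rewrite (last_row_moment _ triF frF).
pose mu := lam - const_mx s.
have MV : (T - s%:M) *m V = V *m diag_mx mu.
  rewrite /mu linearB /= diag_const_mx mulmxBl mulmxBr frV.2.
  by rewrite mul_scalar_mx mul_mx_scalar.
have wE j : (lam 0 j - s) * (Q^T *m V) ord_max j =
    U ord_max ord_max * V ord_max j.
  by rewrite -(conj_last_row MV QU) !mxE.
have wi1 : (Q^T *m V) ord_max i ^+ 2 <= 1.
  by rewrite -real_normK ?num_real // exprn_ile1 ?normr_ge0 ?(orthogonal_entry_le1 _ _ frF.1).
apply: (@le_trans _ _ (\sum_j 8 / gap ^+ 2 * (lam 0 i - s) ^+ 2 *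
    (V ord_max j ^+ 2 * (lam 0 j - lam 0 i) ^+ 2))).
  (* eliminating the pivot between indices [i] and [j]:
     [w'_j (lam_j - s) w_i = (lam_i - s) w'_i w_j] *)
  apply: ler_sum => j _; have [->|ji] := eqVneq j i.
    by rewrite subrr expr0n !mulr0.
  rewrite [leRHS]mulrA ler_wpM2r ?sqr_ge0 //.
  have ljs : gap / 2 <= `|lam 0 j - s|.
    have := ler_normD (lam 0 j - s) (s - lam 0 i).
    rewrite addrA subrK [`|s - _|]distrC; have := gapP ji; lra.
  have ljs2 : (gap / 2) ^+ 2 <= (lam 0 j - s) ^+ 2.
    by rewrite -[leRHS]real_normK ?num_real // ler_pXn2r ?nnegrE ?divr_ge0 ?(ltW gap_gt0).
  have g2 : 0 < gap ^+ 2 by rewrite exprn_gt0.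
  have := wE i; have := wE j.
  move: ((Q^T *m V) ord_max j) ((Q^T *m V) ord_max i) wi1 pi.
  move: (V ord_max i) (V ord_max j) (U ord_max ord_max) => wi wj rho.
  move=> wj' wi' wi'1 pi Ej Ei.
  have E : wj' ^+ 2 * (lam 0 j - s) ^+ 2 * wi ^+ 2 =
      (lam 0 i - s) ^+ 2 * wi' ^+ 2 * wj ^+ 2.
    have -> : wj' ^+ 2 * (lam 0 j - s) ^+ 2 * wi ^+ 2 =
      ((lam 0 j - s) * wj') ^+ 2 * wi ^+ 2 by ring.
    rewrite Ej; have -> : (rho * wj) ^+ 2 * wi ^+ 2 = (rho * wi) ^+ 2 * wj ^+ 2 by ring.
    by rewrite -Ei; ring.
  have h1 : wj' ^+ 2 * (gap ^+ 2 / 8) <= wj' ^+ 2 * (lam 0 j - s) ^+ 2 * wi ^+ 2.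
    rewrite -mulrA ler_wpM2l ?sqr_ge0 //.
    have -> : gap ^+ 2 / 8 = (gap / 2) ^+ 2 * 2^-1 by field.
    by rewrite ler_pM // ?sqr_ge0 // invr_ge0.
  have h2 : (lam 0 i - s) ^+ 2 * wi' ^+ 2 * wj ^+ 2 <= (lam 0 i - s) ^+ 2 * wj ^+ 2.
    by rewrite ler_wpM2r ?sqr_ge0 // ler_piMr ?sqr_ge0.
  have -> : 8 / gap ^+ 2 * (lam 0 i - s) ^+ 2 * wj ^+ 2 =
      (lam 0 i - s) ^+ 2 * wj ^+ 2 / (gap ^+ 2 / 8) by field; rewrite gt_eqF.
  by rewrite ler_pdivlMr ?divr_gt0 // (le_trans h1) // E.
rewrite -mulr_sumr -(last_row_moment _ triT frV).
have -> : 16 / gap ^+ 2 * (lam 0 i - s) ^+ 2 * subdiag_last T ^+ 2 =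
    8 / gap ^+ 2 * (lam 0 i - s) ^+ 2 * (subdiag_last T ^+ 2 + subdiag_last T ^+ 2).
  by field; rewrite gt_eqF.
apply: ler_wpM2l; last by rewrite lerD2r (diag_last_error triT frV).
by apply: mulr_ge0 (sqr_ge0 _); rewrite divr_ge0 ?sqr_ge0.
Qed.

(** The kernel of [T - s] is spanned at most by the [i]-th eigenvector, whose
    last component is nonzero, while a linear relation between the first
    columns is a kernel vector with zero last component. *)
Lemma shift_almost_invertible T V s i : eigenframe lam T V ->
  V ord_max i != 0 -> (forall j, j != i -> lam 0 j != s) ->
  almost_invertible (T - s%:M).
Proof.
move=> frV wi0 sj; have [orthV TV] := frV.
apply: inj_row_free => x xM.
(* [x] completed by a zero last component *)
pose X := x *m (col' ord_max 1%:M)^T.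
have XE l : X 0 (lift ord_max l) = x 0 l.
  rewrite mxE (bigD1 l) //= !mxE eqxx mulr1 big1 ?addr0 // => k kl.
  by rewrite !mxE (inj_eq lift_inj) eq_sym (negbTE kl) mulr0.
suff X0 : X = 0 by apply/matrixP => k l; rewrite ord1 -XE X0 !mxE.
have Xmax : X 0 ord_max = 0.
  by rewrite mxE big1 // => k _; rewrite !mxE (negbTE (neq_lift _ _)) mulr0.
have XM : X *m (T - s%:M) = 0.
  rewrite -xM /X -mulmxA; congr (x *m _).
  rewrite -[T - s%:M in LHS]trmxK -trmx_mul linearB /= (eigenframe_sym frV) tr_scalar_mx.
  congr (_^T); apply/matrixP => k l; rewrite mxE (bigD1 (lift ord_max l)) //=.
  rewrite !mxE eqxx mulr1 big1 ?addr0 // => m ml.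
  by rewrite !mxE (negbTE ml) mulr0.
have XV j : (X *m V) 0 j * (lam 0 j - s) = 0.
  have : (X *m (T - s%:M) *m V) 0 j = 0 by rewrite XM mul0mx mxE.
  rewrite -mulmxA mulmxBl TV mul_scalar_mx mulmxBr -scalemxAr mulmxA mul_mx_diag.
  by move=> E; rewrite -[RHS]E mulrBr [_ * s]mulrC !mxE.
have XVj j : j != i -> (X *m V) 0 j = 0.
  move=> ji; have /eqP := XV j; rewrite mulf_eq0 subr_eq0 (negbTE (sj _ ji)) orbF.
  by move/eqP.
have XVV : X = X *m V *m V^T by rewrite -mulmxA (orthogonalC orthV) mulmx1.
have XVi : (X *m V) 0 i = 0.
  have : X 0 ord_max = (X *m V) 0 i * V ord_max i.
    rewrite [in LHS]XVV mxE (bigD1 i) //= big1 ?addr0 => [|j ji].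
      by rewrite [V^T _ _]mxE.
    by rewrite XVj ?mul0r.
  by rewrite Xmax => /esym/eqP; rewrite mulf_eq0 (negbTE wi0) orbF => /eqP.
rewrite XVV (_ : X *m V = 0) ?mul0mx //; apply/matrixP => k j.
by rewrite ord1 [RHS]mxE; have [->|/XVj] := eqVneq j i.
Qed.

End Gap.

End LastRow.

(** * Retraction onto the matrices with vanishing last subdiagonal entry *)

Section ParityBound.
Variables (R : realType) (n : nat).
Implicit Types X Y Q : 'M[R]_n.+1.

(** Bounds that treat separately the two diagonal blocks (sizes [n] and [1])
    and the two off-diagonal ones.  With [a = d ^+ 2] this is the behaviour of
    the even and odd parts of a function of a small parameter [d]. *)
Definition parity_bound (a d K : R) X : Prop :=
  forall j k, `|X j k| <= K * (if (j == ord_max) == (k == ord_max) then a else d).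

Lemma parity_bound_tr a d K X : parity_bound a d K X -> parity_bound a d K X^T.
Proof. by move=> bX j k; rewrite mxE eq_sym. Qed.

Lemma parity_boundD a d K K' X Y : parity_bound a d K X ->
  parity_bound a d K' Y -> parity_bound a d (K + K') (X + Y).
Proof.
by move=> bX bY j k; rewrite mxE mulrDl (le_trans (ler_normD _ _)) ?lerD.
Qed.

Lemma parity_bound_mul d K K' X Y : 0 <= d <= 1 -> 0 <= K -> 0 <= K' ->
  parity_bound 1 d K X -> parity_bound (d ^+ 2) d K' Y ->
  parity_bound (d ^+ 2) d (n.+1%:R * (K * K')) (X *m Y).
Proof.
move=> /andP[d0 d1] K0 K'0 bX bY j k; rewrite mxE.
apply: le_trans (ler_norm_sum _ _ _) _; set g := if _ then _ else _.
have -> : n.+1%:R * (K * K') * g = \sum_(l < n.+1) K * K' * g.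
  by rewrite sumr_const card_ord -mulrA mulr_natl.
apply: ler_sum => l _; rewrite normrM.
apply: le_trans (ler_pM _ _ (bX j l) (bY l k)) _ => //.
rewrite mulrACA ler_wpM2l ?mulr_ge0 // /g.
have d3 : d * d ^+ 2 <= d by rewrite ler_piMr // exprn_ile1.
by case: (j == _); case: (l == _); case: (k == _) => /=; rewrite ?mul1r ?expr2 // -?expr2.
Qed.

Lemma parity_bound_mulr d K K' X Y : 0 <= d <= 1 -> 0 <= K -> 0 <= K' ->
  parity_bound (d ^+ 2) d K X -> parity_bound 1 d K' Y ->
  parity_bound (d ^+ 2) d (n.+1%:R * (K' * K)) (X *m Y).
Proof.
move=> d01 K0 K'0 bX bY; rewrite -[X *m Y]trmxK trmx_mul.
by apply: parity_bound_tr; apply: parity_bound_mul => //; apply: parity_bound_tr.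
Qed.

(** The rows and the columns of [Q] indexed by [A] have the same total square
    norm, namely the number of elements of [A]. *)
Lemma orthogonal_balance Q (A : pred 'I_n.+1) : Q^T *m Q = 1%:M ->
  \sum_(j | A j) \sum_(k | ~~ A k) Q j k ^+ 2 =
  \sum_(k | A k) \sum_(j | ~~ A j) Q j k ^+ 2.
Proof.
move=> orthQ.
apply: (addrI (\sum_(j | A j) \sum_(k | A k) Q j k ^+ 2)).
rewrite [in RHS]exchange_big -!big_split /=.
transitivity (\sum_(j | A j) (1 : R)); last symmetry.
  by apply: eq_bigr => j _; rewrite -(orthogonal_row2 j orthQ) [RHS](bigID A).
by apply: eq_bigr => j _; rewrite -(orthogonal_col2 j orthQ) [RHS](bigID A).
Qed.

(** If the leading block of an orthogonal [Q] is lower triangular with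
    nonnegative diagonal and the corner entry differs from [1] by
    [O(d ^+ 2)], then [Q - 1] is [O(d ^+ 2)] in the diagonal blocks.
    [orthogonal_balance] bounds the entries below the diagonal by [d], and the
    orthogonality of two rows improves this bound to a multiple of
    [d ^+ 2]. *)
Lemma near_identity Q d : Q^T *m Q = 1%:M ->
  (forall j k : 'I_n.+1, (j < k)%N -> (k < n)%N -> Q j k = 0) ->
  (forall j, 0 <= Q j j) -> 0 <= d -> 1 - d ^+ 2 <= Q ord_max ord_max ^+ 2 ->
  n.+1%:R * d ^+ 2 <= 3 / 4 ->
  parity_bound (d ^+ 2) d (2 * n.+1%:R) (Q - 1%:M).
Proof.
move=> orthQ lowQ Q0 d0 Qmax dn.
have lt_max (k : 'I_n.+1) : k != ord_max -> (k < n)%N.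
  by move=> km; rewrite ltn_neqAle -ltnS ltn_ord andbT.
have rowmax : \sum_(k | k != ord_max) Q ord_max k ^+ 2 <= d ^+ 2.
  have := orthogonal_row2 ord_max orthQ; rewrite (bigD1 ord_max) //= => E.
  by move: Qmax; rewrite -E; lra.
have colmax : \sum_(k | k != ord_max) Q k ord_max ^+ 2 <= d ^+ 2.
  have := orthogonal_col2 ord_max orthQ; rewrite (bigD1 ord_max) //= => E.
  by move: Qmax; rewrite -E; lra.
have off2 j k : j != k -> Q j k ^+ 2 <= d ^+ 2.
  move=> jk; have [jm|jm] := eqVneq j ord_max.
    rewrite jm; apply: le_trans rowmax; rewrite (bigD1 k) /= -?jm 1?eq_sym //.
    by rewrite lerDl sumr_ge0 // => l _; rewrite sqr_ge0.
  have [km|km] := eqVneq k ord_max.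
    rewrite km; apply: le_trans colmax; rewrite (bigD1 j) //=.
    by rewrite lerDl sumr_ge0 // => l _; rewrite sqr_ge0.
  case: (ltngtP j k) => [jltk|kltj|/val_inj e]; last by rewrite e eqxx in jk.
    by rewrite lowQ ?lt_max // expr0n sqr_ge0.
  pose A := [pred l : 'I_n.+1 | (j <= l < n)%N].
  have Aj : A j by rewrite /A /= leqnn lt_max.
  have Ak : ~~ A k by rewrite /A /= leqNgt kltj.
  apply: (@le_trans _ _ (\sum_(l | A l) \sum_(m | ~~ A m) Q l m ^+ 2)).
    rewrite (bigD1 j) //= (bigD1 k) //= -addrA lerDl addr_ge0 //.
      by rewrite sumr_ge0 // => m _; rewrite sqr_ge0.
    by rewrite sumr_ge0 // => l _; rewrite sumr_ge0 // => m _; rewrite sqr_ge0.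
  rewrite orthogonal_balance //; apply: le_trans rowmax.
  rewrite [leRHS](bigID A) /= ler_wpDr ?sumr_ge0 // => [m _|]; first by rewrite sqr_ge0.
  rewrite (eq_bigl (fun l => (l != ord_max) && A l)); last first.
    move=> l; rewrite /A /=; have [->|//] := eqVneq l ord_max.
    by rewrite /= ltnn !andbF.
  apply: ler_sum => m /andP[mm /andP[jlem mltn]].
  (* a row outside of [A] other than the last one lies above the diagonal *)
  rewrite (bigD1 ord_max) //= ?ltnn ?andbF // big1 ?addr0 // => l /andP[lA lm].
  rewrite lowQ ?expr0n //.
  by move: lA; rewrite negb_and (lt_max _ lm) orbF -ltnNge => /leq_trans; apply.
have off j k : j != k -> `|Q j k| <= d.
  move=> jk; rewrite -(@ler_pXn2r _ 2) ?nnegrE // real_normK ?num_real //.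
  exact: off2.
have sum_off j (f : 'I_n.+1 -> R) : (forall k, k != j -> f k <= d ^+ 2) ->
    \sum_(k | k != j) f k <= n.+1%:R * d ^+ 2.
  move=> fd; rewrite mulr_natl; have -> : d ^+ 2 *+ n.+1 = \sum_(k < n.+1) d ^+ 2.
    by rewrite sumr_const card_ord.
  rewrite [leRHS](bigID (fun k => k != j)) /= ler_wpDr ?sumr_ge0 // => [k _|].
    by rewrite sqr_ge0.
  exact: ler_sum.
have diag2 j : 1 - n.+1%:R * d ^+ 2 <= Q j j ^+ 2.
  have := orthogonal_row2 j orthQ; rewrite (bigD1 j) //= => E.
  have := sum_off j (fun k => Q j k ^+ 2).
  have h : forall k, k != j -> Q j k ^+ 2 <= d ^+ 2.
    by move=> k kj; rewrite off2 // eq_sym.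
  by move/(_ h); lra.
have diag_ge j : 2^-1 <= Q j j.
  rewrite -(@ler_pXn2r _ 2) ?nnegrE ?invr_ge0 ?Q0 //.
  by apply: le_trans (diag2 j); rewrite expr2; lra.
have diag_le j : Q j j <= 1.
  by have := orthogonal_entry_le1 j j orthQ; rewrite ger0_norm.
have nd0 : 0 <= n.+1%:R * d ^+ 2 by rewrite mulr_ge0 ?sqr_ge0.
have n1 : 1 <= n.+1%:R :> R by rewrite ler1n.
have low (j l : 'I_n.+1) : (l < j)%N -> j != ord_max -> `|Q j l| <= 2 * n.+1%:R * d ^+ 2.
  move=> lj jm.
  have jl : j != l by rewrite -val_eqE neq_ltn lj orbT.
  have := orthogonal_row j l orthQ; rewrite (negbTE jl) (bigD1 l) //=.
  set S := \sum_(_ | _) _ => /eqP; rewrite addr_eq0 => /eqP E.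
  have : `|S| <= n.+1%:R * d ^+ 2.
    apply: le_trans (ler_norm_sum _ _ _) _; apply: sum_off => k kl.
    have [->|kj] := eqVneq k j.
      by rewrite (lowQ l j) ?lt_max // mulr0 normr0 sqr_ge0.
    by rewrite normrM expr2 ler_pM // off // eq_sym.
  rewrite -normrN -E normrM (ger0_norm (Q0 l)) => h.
  have := ler_wpM2l (normr_ge0 (Q j l)) (diag_ge l); lra.
move=> j k; rewrite !mxE; have [<-|jk] := eqVneq j k.
  rewrite eqxx mulr1n distrC ger0_norm ?subr_ge0 //.
  have := diag2 j; have := ler_wpM2l (Q0 j) (diag_le j); rewrite -expr2 mulr1; lra.
rewrite subr0; have [jm|jm] := eqVneq j ord_max.
  rewrite ifF; last by rewrite -jm [k == j]eq_sym (negbTE jk).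
  by apply: le_trans (off _ _ jk) _; rewrite ler_peMl //; lra.
have [km|km] := eqVneq k ord_max.
  by apply: le_trans (off _ _ jk) _; rewrite /= ler_peMl //; lra.
rewrite eqxx; case: (ltngtP j k) => [jltk|kltj|/val_inj e].
- by rewrite lowQ ?lt_max // normr0 mulr_ge0 ?sqr_ge0 ?mulr_ge0.
- exact: low.
- by rewrite e eqxx in jk.
Qed.

End ParityBound.

Section Retraction.
Variables (R : realType) (n : nat).
Implicit Types (T V Q U : 'M[R]_n.+3) (lam : 'rV[R]_n.+3).

(** A QR step driven by the orthogonal projection [P] onto the complement of
    the [i]-th eigenvector instead of [T - s]: the last pivot of [P] is zero,
    so one step deflates.  As [Q^T P] agrees with [Q^T] outside of the last
    row, [Q] is lower triangular apart from its last column, which is a unit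
    eigenvector. *)
Lemma deflating_rotation lam T V i : isospectral lam T -> eigenframe lam T V ->
  V ord_max i != 0 -> exists Q, let F := Q^T *m T *m Q in
  [/\ Q^T *m Q = 1%:M, isospectral lam F,
      F ord_max ord_max = lam 0 i /\ (forall k, k != ord_max -> F ord_max k = 0),
      forall j k : 'I_n.+3, (j < k)%N -> (k < n.+2)%N -> Q j k = 0 &
      (forall j, 0 <= Q j j) /\ Q ord_max ord_max ^+ 2 = V ord_max i ^+ 2].
Proof.
move=> [symT triT specT] frV wi0; have [orthV TV] := frV.
pose mu : 'rV[R]_n.+3 := \row_j (j != i)%:R.
pose P := V *m diag_mx mu *m V^T.
have frP : eigenframe mu P V by split=> //; rewrite /P -!mulmxA orthV mulmx1.
have commP : P *m T = T *m P.
  rewrite /P (eigenframeE frV) !mulmxA -!(mulmxA _ V^T V) orthV !mulmx1.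
  rewrite -!(mulmxA V) !mulmx_diag; congr (_ *m (diag_mx _ *m _)).
  by apply/matrixP => j k; rewrite !mxE mulrC.
have aiP : almost_invertible P.
  rewrite -[P]subr0 -(raddf0 (@scalar_mx _ _)).
  by apply: (shift_almost_invertible frP wi0) => j ji; rewrite mxE ji oner_neq0.
have [Q [U [QU Qmax]]] : exists Q U, QR_factors P Q U /\ 0 <= Q ord_max ord_max.
  have [Q [U QU]] := QR_factors_exists aiP.
  have [Q0|Q0] := lerP 0 (Q ord_max ord_max); first by exists Q, U.
  exists (Q *m last_sign n.+2 (-1)), (last_sign n.+2 (-1) *m U).
  split; first by apply: QR_factors_flip QU; rewrite mulrNN mulr1.
  by rewrite mulr_last_sign eqxx mulrN1 oppr_ge0 ltW.
have [PE orthQ upU posU] := QU.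
have [W WE] : exists W, W = Q^T *m V by exists (Q^T *m V).
set F := Q^T *m T *m Q.
have frF : eigenframe lam F W by rewrite WE; exact: conj_eigenframe.
have [orthW _] := frF.
have triF : tridiagonal F by exact: (conj_tridiagonal symT triT commP QU).
have lastW := conj_last_row frP.2 QU; rewrite -WE in lastW.
have Umax : U ord_max ord_max = 0.
  have /esym/eqP := lastW i; rewrite mxE eqxx mul0r mulf_eq0 (negbTE wi0) orbF.
  by move/eqP.
have W0 j : j != i -> W ord_max j = 0.
  by move=> ji; have := lastW j; rewrite mxE ji mul1r Umax mul0r.
have lastE (f : 'I_n.+3 -> R) :
    \sum_j W ord_max j * f j = W ord_max i * f i.
  by rewrite (bigD1 i) //= big1 ?addr0 // => j ji; rewrite W0 ?mul0r.
have Wi2 : W ord_max i * W ord_max i = 1.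
  by rewrite -(lastE (W ord_max)) orthogonal_row ?eqxx.
have Wi0 : W ord_max i != 0.
  by apply: contraTneq (oner_neq0 R) => e; rewrite -Wi2 e mul0r eqxx.
have Wk k : k != ord_max -> W k i = 0.
  move=> km; have := orthogonal_row ord_max k orthW.
  rewrite lastE eq_sym (negbTE km) => /eqP; rewrite mulf_eq0 (negbTE Wi0).
  by move/eqP.
have FE k : F ord_max k = W ord_max i * (lam 0 i * W k i).
  rewrite (eigenframeE frF) mul_mx_diag mxE -(lastE (fun j => lam 0 j * W k j)).
  by apply: eq_bigr => j _; rewrite !mxE mulrA.
have QVW : Q^T = W *m V^T by rewrite WE -mulmxA (orthogonalC orthV) mulmx1.
have QE j : Q j ord_max = W ord_max i * V j i.
  have -> : Q j ord_max = Q^T ord_max j by rewrite mxE.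
  rewrite QVW mxE -(lastE (V j)).
  by apply: eq_bigr => k _; rewrite [V^T _ _]mxE.
have UE k l : k != ord_max -> U k l = Q l k.
  move=> km; have -> : U = W *m diag_mx mu *m V^T.
    by rewrite -[U]mul1mx -orthQ -mulmxA -PE /P WE !mulmxA.
  have -> : Q l k = Q^T k l by rewrite mxE.
  rewrite QVW mul_mx_diag mxE [RHS]mxE; apply: eq_bigr => j _.
  rewrite !mxE; have [->|ji] := eqVneq j i; first by rewrite Wk ?mul0r.
  by rewrite mulr1.
exists Q; split=> //.
- split=> //; first exact: eigenframe_sym frF.
  exact: eigenframe_spectrum frF.
- split=> [|k km]; first by rewrite FE mulrCA Wi2 mulr1.
  by rewrite FE (Wk k km) !mulr0.
- move=> j k jk kn; rewrite -UE ?upU // -val_eqE /= neq_ltn kn //.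
- split=> [j|]; last by rewrite QE exprMn expr2 Wi2 mul1r.
  have [->//|jm] := eqVneq j ord_max.
  rewrite -UE // ltW // posU // ltn_neqAle -ltnS ltn_ord andbT.
  by rewrite -val_eqE in jm.
Qed.

Lemma isospectral_entry_le lam T V j k : eigenframe lam T V ->
  `|T j k| <= \sum_l `|lam 0 l|.
Proof.
move=> frV; have [orthV _] := frV.
rewrite (eigenframeE frV) mul_mx_diag mxE (le_trans (ler_norm_sum _ _ _)) //.
apply: ler_sum => l _; rewrite !mxE !normrM -mulrA.
rewrite mulrCA ler_piMr // mulr_ile1 //; exact: orthogonal_entry_le1.
Qed.

(** The rotation of [deflating_rotation] differs from the identity by a matrix
    [X] with the parity bounds of [near_identity], and so does [Q^T T Q] from
    [T], because the last coupling of [T] is itself of order [d]. *)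
Lemma retraction lam : exists2 K, 0 < K & forall T V i d,
  isospectral lam T -> eigenframe lam T V -> 0 <= d ->
  `|subdiag_last T| <= d -> n.+3%:R * d ^+ 2 <= 3 / 4 ->
  1 - d ^+ 2 <= V ord_max i ^+ 2 ->
  exists T1, [/\ isospectral lam T1, subdiag_last T1 = 0,
    T1 ord_max ord_max = lam 0 i & parity_bound (d ^+ 2) d K (T1 - T)].
Proof.
pose N : R := n.+3%:R; pose c := 1 + \sum_l `|lam 0 l|.
pose K1 := N * (c * (2 * N)); pose K2 := N * (K1 * (2 * N)).
have N1 : 1 <= N by rewrite /N ler1n.
have c1 : 1 <= c by rewrite /c lerDl sumr_ge0.
have K1gt0 : 0 < K1 by rewrite /K1 !mulr_gt0 //; lra.
have K2gt0 : 0 < K2 by rewrite /K2 !mulr_gt0 //; lra.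
exists (K1 + (K1 + K2)); first by rewrite !addr_gt0.
move=> T V i d isoT frV d0 bd Nd wi.
have d21 : d ^+ 2 <= 3 / 4.
  by apply: le_trans Nd; rewrite ler_peMl ?sqr_ge0.
have d1 : d <= 1 by rewrite -(@ler_pXn2r _ 2) ?nnegrE // expr1n (le_trans d21) //; lra.
have wi0 : V ord_max i != 0.
  by apply: contraTneq wi => ->; rewrite expr0n -ltNge /=; lra.
have [Q [orthQ isoF [Fmax F0] lowQ [Q0 Qmax]]] := deflating_rotation isoT frV wi0.
exists (Q^T *m T *m Q); split=> //; first by rewrite /subdiag_last F0 ?pen_neq_max.
pose X := Q - 1%:M; have QX : Q = 1%:M + X by rewrite addrC subrK.
have bX : parity_bound (d ^+ 2) d (2 * N) X.
  by apply: near_identity => //; rewrite Qmax.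
have bT : parity_bound 1 d c T.
  have [symT triT _] := isoT.
  have lastT k : k != ord_max -> `|T ord_max k| <= c * d.
    move=> km; have [->|kp] := eqVneq k (inord n.+1).
      by apply: le_trans bd _; rewrite ler_peMl.
    by rewrite tridiagonal_last // normr0 mulr_ge0 //; lra.
  move=> j k; have [jm|jm] := eqVneq j ord_max.
    have [km|km] := eqVneq k ord_max.
      by rewrite /= mulr1 (le_trans (isospectral_entry_le _ _ frV)) // lerDr.
    by rewrite jm lastT.
  have [km|km] := eqVneq k ord_max.
    by rewrite /= -symT mxE km lastT.
  by rewrite /= mulr1 (le_trans (isospectral_entry_le _ _ frV)) // lerDr.
have d01 : 0 <= d <= 1 by rewrite d0.
have -> : Q^T *m T *m Q - T = T *m X + (X^T *m T + X^T *m T *m X).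
  have QT : Q^T = 1%:M + X^T by rewrite QX -[in RHS]trmx1 -linearD.
  clearbody X; rewrite QT {1}QX mulmxDl mulmxDr mul1mx mulmx1 mulmxDl.
  by rewrite [LHS]addrC !addrA addNr add0r [X in X + _]addrC.
have N20 : 0 <= 2 * N by rewrite mulr_ge0 //; lra.
have c0 : 0 <= c by lra.
have bXT : parity_bound (d ^+ 2) d K1 (X^T *m T).
  by apply: parity_bound_mulr => //; apply: parity_bound_tr.
apply: parity_boundD; first exact: parity_bound_mul.
apply: parity_boundD; first exact: bXT.
apply: parity_bound_mul => //; first exact: ltW.
move=> j k; apply: le_trans (bXT j k) _; rewrite ler_wpM2l ?(ltW K1gt0) //.
by case: ifP => // _; lra.
Qed.

End Retraction.

(** * Second-order estimates for smooth functions *)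

Section SmoothEstimates.
Variables (R : realType).

Lemma is_derive_line (V : normedModType R) (g : V -> R) (x v : V) (t : R) :
  differentiable g (x + t *: v) ->
  is_derive t 1 (fun s : R => g (x + s *: v)) ('D_v g (x + t *: v)).
Proof.
move=> dg; have dv : derivable g (x + t *: v) v by exact: diff_derivable.
have E : (fun h : R => h^-1 *: (((fun s : R => g (x + s *: v)) \o shift t) (h *: 1)
      - g (x + t *: v))) =
    (fun h : R => h^-1 *: ((g \o shift (x + t *: v)) (h *: v) - g (x + t *: v))).
  apply/funext => h /=; congr (_ *: (g _ - _)).
  by rewrite scalerDl -[h *: 1]/(h * 1) mulr1 addrCA.
by split; rewrite /derivable /derive E.
Qed.

Lemma derive_bound_diff (f df : R -> R) (rho K : R) :
  (forall s : R, `|s| <= rho -> is_derive s 1 f (df s) /\ `|df s| <= K) ->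
  forall a b, `|a| <= rho -> `|b| <= rho -> `|f b - f a| <= K * `|b - a|.
Proof.
move=> fP; suff main a b : a <= b -> `|a| <= rho -> `|b| <= rho ->
    `|f b - f a| <= K * `|b - a|.
  move=> a b ra rb; have [ab|/ltW ba] := leP a b; first exact: main.
  by rewrite distrC [`|b - a|]distrC; exact: main.
move=> ab ra rb; have sr s : s \in `[a, b]%R -> `|s| <= rho.
  rewrite in_itv /= => /andP[as_ sb]; rewrite ler_norml.
  move: ra rb; rewrite !ler_norml => /andP[ra _] /andP[_ rb].
  by rewrite (le_trans ra) // (le_trans sb).
have drv (s : R) : s \in `]a, b[%R -> is_derive s 1 f (df s).
  by move=> /subset_itv_oo_cc sab; have [] := fP s (sr s sab).
have cont : {within `[a, b], continuous f}.
  apply: derivable_within_continuous => s sab.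
  by have [[]] := fP s (sr s sab).
have [c cab ->] := MVT_segment ab drv cont.
by rewrite normrM ler_wpM2r //; have [] := fP c (sr c cab).
Qed.

Lemma continuous_bounded_near (V : normedModType R) (f : V -> R) (x : V) :
  {for x, continuous f} ->
  exists K, [/\ 0 <= K & \forall y \near x, `|f y| <= K].
Proof.
move=> fx; exists (`|f x| + 1); split; first by rewrite addr_ge0.
have /cvgr_dist_le/(_ 1 ltr01) : f @ x --> f x by exact: fx.
apply: filterS => y; rewrite -lerBlDl; apply: le_trans.
by rewrite distrC lerB_dist.
Qed.

Lemma near_ball_norm (V : normedModType R) (x : V) (P : set V) :
  (\forall y \near x, P y) ->
  exists2 r, 0 < r & forall y, `|x - y| < r -> P y.
Proof.
move=> /nbhs_ballP[r /= r0 rP]; exists r => // y xy.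
by apply: rP; rewrite -ball_normE.
Qed.

(** A value taken at both [y + t v] and [y - t v] forces, by Rolle, a zero of
    the derivative along [v] between these points. *)
Lemma even_second_order (V : normedModType R) (g : V -> R) (U : set V) (x v : V) :
  open U -> U x -> classC 2 U g ->
  exists r K, [/\ 0 < r, 0 <= K & forall y t, `|x - y| < r -> `|t| < r ->
    g (y + t *: v) = g (y - t *: v) -> `|g (y + t *: v) - g y| <= K * t ^+ 2].
Proof.
move=> oU Ux [dg /(_ v)[dDg /(_ v) cDDg]].
have [K [K0 /near_ball_norm[r1 r10 r1P]]] := continuous_bounded_near (cDDg x Ux).
have [r2 r20 r2P] := near_ball_norm (open_nbhs_nbhs (conj oU Ux)).
pose rho := Num.min r1 r2; have rho0 : 0 < rho by rewrite lt_min r10.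
have v1 : 0 < 1 + `|v| by rewrite ltr_wpDr.
exists (rho / (1 + `|v|)), (2 * K); split; first by rewrite divr_gt0.
  by rewrite mulr_ge0.
move=> y t xy tr gE.
have inU s : `|s| <= `|t| -> U (y + s *: v) /\ `|'D_v (fun z => 'D_v g z) (y + s *: v)| <= K.
  move=> st; have : `|x - (y + s *: v)| < rho.
    rewrite opprD addrA (le_lt_trans (ler_normB _ _)) // normrZ.
    have -> : rho = rho / (1 + `|v|) + rho / (1 + `|v|) * `|v|.
      by field; rewrite gt_eqF.
    rewrite ltr_leD // ler_wpM2r // ltW // (le_lt_trans st) //.
  by rewrite lt_min => /andP[h1 h2]; split; [exact: r2P|exact: r1P].
have [t0|t0] := eqVneq t 0.
  by rewrite t0 scale0r addr0 subrr normr0 expr0n mulr0.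
(* a zero [c] of [df] by Rolle, then twice the mean value theorem *)
pose f s := g (y + s *: v); pose df s := 'D_v g (y + s *: v).
pose ddf s := 'D_v (fun z => 'D_v g z) (y + s *: v).
have fP (s : R) : `|s| <= `|t| -> is_derive s 1 f (df s).
  by move=> /inU[Us _]; apply: is_derive_line; apply: dg.
have dfP (s : R) : `|s| <= `|t| -> is_derive s 1 df (ddf s) /\ `|ddf s| <= K.
  move=> /inU[Us dK]; split; last exact: dK.
  exact: (@is_derive_line _ (fun z => 'D_v g z) y v s (dDg _ Us)).
have at_ s : s \in `[(- `|t|), `|t|]%R -> `|s| <= `|t|.
  by rewrite in_itv /= ler_norml.
have fE : f (- `|t|) = f `|t|.
  rewrite /f; have [_|_] := ger0P t; first by rewrite scaleNr gE.
  by rewrite opprK scaleNr gE.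
have [c /subset_itv_oo_cc/at_ ct [_ dc]] : exists2 c, c \in `](- `|t|), `|t|[%R &
    is_derive c 1 f 0.
  apply: Rolle => //.
  - by rewrite gtrN // normr_gt0.
  - by move=> s /subset_itv_oo_cc/at_/fP[].
  - by apply: derivable_within_continuous => s /at_/fP[].
have dfc : df c = 0 by have [_ <-] := fP c ct.
have dfK s : `|s| <= `|t| -> `|df s| <= 2 * K * `|t|.
  move=> st; have := derive_bound_diff dfP ct st; rewrite dfc subr0.
  move/le_trans; apply; rewrite -mulrA mulrCA ler_wpM2l //.
  by rewrite (le_trans (ler_normB _ _)) // mulr2n mulrDl !mul1r lerD.
have := derive_bound_diff (fun s st => conj (fP s st) (dfK s st)) _ (lexx `|t|).
move=> /(_ 0); rewrite normr0 normr_ge0 => /(_ isT).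
rewrite /f scale0r addr0 subr0 -(mulrA (2 * K) `|t| `|t|) -[_ * `|t|]expr2.
by rewrite real_normK ?num_real.
Qed.

Lemma locally_lipschitz m n (g : 'M[R]_(m.+1, n.+1) -> R) U x :
  open U -> U x -> classC 1 U g ->
  exists r K, [/\ 0 < r, 0 <= K & forall y z, `|x - y| < r -> `|x - z| < r ->
    `|g y - g z| <= K * `|y - z|].
Proof.
move=> oU Ux [dg cDg].
have /choice[K KP] (ij : 'I_m.+1 * 'I_n.+1) : exists K, 0 <= K /\
    \forall y \near x, `|'D_(delta_mx ij.1 ij.2) g y| <= K.
  by have [K []] := continuous_bounded_near (cDg (delta_mx ij.1 ij.2) x Ux); exists K.
pose C := \sum_ij K ij.
have /near_ball_norm[r1 r10 r1P] :
    \forall y \near x, forall ij, `|'D_(delta_mx ij.1 ij.2) g y| <= K ij.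
  apply: (@filter_forall _ _ (fun ij y => `|'D_(delta_mx ij.1 ij.2) g y| <= K ij) (nbhs x)).
  by move=> ij; have [] := KP ij.
have [r2 r20 r2P] := near_ball_norm (open_nbhs_nbhs (conj oU Ux)).
pose rho := Num.min r1 r2; have rho0 : 0 < rho by rewrite lt_min r10.
have DgC y v : `|x - y| < rho -> `|'D_v g y| <= C * `|v|.
  rewrite lt_min => /andP[h1 h2]; have dgy := dg y (r2P y h2).
  rewrite deriveE // {1}(matrix_sum_delta v) pair_big /= linear_sum.
  rewrite (le_trans (ler_norm_sum _ _ _)) // mulr_suml ler_sum // => ij _.
  rewrite linearZ /= -deriveE // -[_ *: _]/(_ * _) normrM mulrC ler_pM //.
    exact: r1P.
  rewrite [leRHS]/Num.norm /= mx_normrE; apply/bigmax_geP; right => /=.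
  by exists ij.
exists (rho / 3), C; split; [by rewrite divr_gt0|by apply: sumr_ge0 => ij _; have [] := KP ij|].
move=> y z xy xz.
have yz : `|y - z| < rho / 3 + rho / 3.
  by rewrite -[y - z](subrKA x) (le_lt_trans (ler_normD _ _)) // ltrD // distrC.
have /(_ _ 0 1) := @derive_bound_diff (fun s => g (z + s *: (y - z)))
  (fun s => 'D_(y - z) g (z + s *: (y - z))) 1 (C * `|y - z|).
rewrite normr0 normr1 ler01 lexx scale0r addr0 scale1r subr0 normr1 mulr1.
have -> : z + (y - z) = y by rewrite addrC subrK.
apply=> // s s1.
have : `|x - (z + s *: (y - z))| < rho.
  rewrite opprD addrA (le_lt_trans (ler_normB _ _)) // normrZ.
  have : `|s| * `|y - z| <= `|y - z| by rewrite ler_piMl.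
  lra.
move=> xs; split; last exact: DgC.
by apply/is_derive_line/dg/r2P; move: xs; rewrite lt_min => /andP[].
Qed.

End SmoothEstimates.

(** * Quadratic accuracy of the shift near a smooth doubly deflated point *)

Section QuadraticShift.
Variables (R : realType) (n : nat).
Implicit Types (T V : 'M[R]_n.+3) (lam : 'rV[R]_n.+3).

Local Notation pen := (inord n.+1 : 'I_n.+3).

Lemma mx_norm_le m p (X : 'M[R]_(m, p)) (c : R) :
  0 <= c -> (forall i j, `|X i j| <= c) -> `|X| <= c.
Proof.
move=> c0 Xc; rewrite [leLHS]/Num.norm /= mx_normrE.
by apply/bigmax_leP; split=> // ij _; exact: Xc.
Qed.

Lemma mx_entry_le_norm m p (X : 'M[R]_(m, p)) i j : `|X i j| <= `|X|.
Proof.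
rewrite [leRHS]/Num.norm /= mx_normrE; apply/bigmax_geP; right => /=.
by exists (i, j).
Qed.

(** Subtracting a multiple of it changes the last subdiagonal entry and keeps
    the matrix symmetric. *)
Definition last_coupling : 'M[R]_n.+3 :=
  delta_mx ord_max pen + delta_mx pen ord_max.

Lemma last_coupling_tr : last_coupling^T = last_coupling.
Proof. by rewrite /last_coupling linearD /= !trmx_delta addrC. Qed.

Lemma last_coupling_max k : last_coupling ord_max k = (k == pen)%:R.
Proof.
rewrite !mxE eqxx /= [ord_max == pen]eq_sym (negbTE (@pen_neq_max n)) /=.
by rewrite addr0.
Qed.

Lemma last_coupling0 j k : j != ord_max -> k != ord_max -> last_coupling j k = 0.
Proof. by move=> /negbTE jm /negbTE km; rewrite !mxE jm km andbF addr0. Qed.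

Lemma last_sign_conj T : T^T = T -> tridiagonal T ->
  last_sign n.+2 (-1) *m T *m last_sign n.+2 (-1) =
  T - (2 * subdiag_last T) *: last_coupling.
Proof.
move=> symT triT; set E := last_sign _ _.
have rowmax k : (E *m T *m E) ord_max k =
    (T - (2 * subdiag_last T) *: last_coupling) ord_max k.
  rewrite mulr_last_sign mul_last_sign eqxx.
  rewrite 3![in RHS]mxE last_coupling_max.
  have [->|km] := eqVneq k ord_max.
    by rewrite [ord_max == pen]eq_sym (negbTE (@pen_neq_max n)) /= mulr0 subr0 mulN1r mulrN1 opprK.
  have [->|kp] := eqVneq k pen; first by rewrite /subdiag_last /= !mulr1; ring.
  by rewrite tridiagonal_last //= !(mulr0, mul0r, subr0).
have symL : (E *m T *m E)^T = E *m T *m E.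
  by rewrite !trmx_mul tr_last_sign symT mulmxA.
have symR : (T - (2 * subdiag_last T) *: last_coupling)^T =
    T - (2 * subdiag_last T) *: last_coupling.
  by rewrite linearB linearZ /= last_coupling_tr symT.
apply/matrixP => j k; have [->|jm] := eqVneq j ord_max; first exact: rowmax.
have [->|km] := eqVneq k ord_max; first by rewrite -symL -symR 2![_^T _ _]mxE.
rewrite mulr_last_sign mul_last_sign (negbTE jm) (negbTE km).
by rewrite 3![in RHS]mxE last_coupling0 //; ring.
Qed.

Lemma last_sign_diagonal : sign_diagonal (last_sign n.+2 (-1) : 'M[R]_n.+3).
Proof.
by eexists; split; last reflexivity; move=> i; rewrite mxE; case: ifP; [right|left].
Qed.

Lemma last_sign_isospectral lam T : increasing lam -> isospectral lam T ->
  isospectral lam (last_sign n.+2 (-1) *m T *m last_sign n.+2 (-1)).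
Proof.
move=> incr [symT triT specT]; have [V frV] := eigenframe_exists incr symT specT.
set E := last_sign _ _.
have orthE : E^T *m E = 1%:M.
  by rewrite tr_last_sign last_signK // mulrNN mulr1.
have frE := conj_eigenframe orthE frV; rewrite tr_last_sign in frE.
split; [exact: eigenframe_sym frE| |exact: eigenframe_spectrum frE].
by move=> j k jk; rewrite mulr_last_sign mul_last_sign triT // mulr0 mul0r.
Qed.

Lemma last_weight_near1 lam (gap : R) T V i : 0 < gap ->
  (forall i j, i != j -> gap <= `|lam 0 i - lam 0 j|) ->
  tridiagonal T -> eigenframe lam T V -> 2^-1 <= V ord_max i ^+ 2 ->
  1 - ((1 + 2 / gap) * `|subdiag_last T|) ^+ 2 <= V ord_max i ^+ 2.
Proof.
move=> gap0 gapP triT frV pi.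
have h1 := last_weight_defect gap0 gapP i triT frV.
have h2 := diag_last_error triT frV pi; clear gapP triT frV pi.
have h3 : (1 - V ord_max i ^+ 2) * gap ^+ 2 <=
    ((1 + 2 / gap) * `|subdiag_last T|) ^+ 2 * gap ^+ 2.
  apply: le_trans h1 _; rewrite exprMn real_normK ?num_real //.
  rewrite mulrAC -exprMn mulrDl mul1r divfK ?gt_eqF // expr2.
  have : 2 * 2 * subdiag_last T ^+ 2 <= (gap + 2) * (gap + 2) * subdiag_last T ^+ 2.
    by rewrite ler_wpM2r ?sqr_ge0 // ler_pM //; lra.
  by have := sqr_ge0 (subdiag_last T); lra.
by move: h3; rewrite ler_pM2r ?exprn_gt0 //; lra.
Qed.

(** With [E] the sign matrix changing the last coordinate, write [T1] for the
    retraction of [T] and [M] for the average of [T] and [E T E], that is [T]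
    with its last coupling erased.  The shift takes the
    same value at [T] and [E T E], hence differs from its smooth extension at
    [M] by [O(b ^+ 2)]; as [M - T1] is [O(b ^+ 2)] too and the shift at [T1] is
    the eigenvalue, the error of the shift at [T] is [O(b ^+ 2)]. *)
Lemma quadratic_shift lam sigma (gap : R) T0 :
  increasing lam -> 0 < gap ->
  (forall i j, i != j -> gap <= `|lam 0 i - lam 0 j|) ->
  simple_shift lam sigma -> double_deflation lam T0 ->
  ~ singular_support lam sigma T0 ->
  exists r K, [/\ 0 < r, 0 <= K & forall T V i, `|T0 - T| < r ->
    isospectral lam T -> eigenframe lam T V -> 2^-1 <= V ord_max i ^+ 2 ->
    `|sigma T - lam 0 i| <= K * subdiag_last T ^+ 2].
Proof.
move=> incr gap0.
(* [m] is the factor of [last_weight_near1] *)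
pose m := 1 + 2 / gap; pose N : R := n.+3%:R.
have m1 : 1 <= m by rewrite /m lerDl divr_ge0 // ltW.
have N1 : 1 <= N by rewrite /N ler1n.
have m0 : 0 < m := lt_le_trans ltr01 m1.
have N0 : 0 < N := lt_le_trans ltr01 N1.
move=> gapP [sigmaE [C [C0 sigmaC]]] [isoT0 b0 a0] suppT0.
have [S [clS Siso smS ST0]] : exists S, [/\ closed S, S `<=` isospectral lam,
    smooth_on (isospectral lam `\` S) sigma & ~ S T0].
  apply: contra_notP suppT0 => noS S [clS Siso smS].
  by apply: contra_notP noS => ST0; exists S.
have [U [g [oU UT0 gC gE]]] := smS T0 (conj isoT0 ST0).
have [r1 [K1 [r10 K10 even_g]]] := even_second_order last_coupling oU UT0 (gC 2%N).
have [r2 [K2 [r20 K20 lip_g]]] := locally_lipschitz oU UT0 (gC 1%N).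
have oW : open (U `&` ~` S) by apply: openI => //; exact: closed_openC.
have [r3 r30 r3P] := near_ball_norm (open_nbhs_nbhs (conj oW (conj UT0 ST0))).
have gsigma T : `|T0 - T| < r3 -> isospectral lam T -> g T = sigma T.
  by move=> /r3P[UT ST] isoT; apply: gE.
have [K K0 retr] := retraction lam.
pose B := `|last_coupling|; have B0 : 0 <= B by exact: normr_ge0.
(* the local estimates hold within [rho] of [T0]; the points attached to [T]
   all lie within [r * L = rho] of [T0] when [T] lies within [r] *)
pose rho := Num.min (Num.min r1 r2) (Num.min r3 1).
have rho0 : 0 < rho by rewrite !lt_min r10 r20 r30 ltr01.
pose L := 1 + 2 * B + K * m + 2 * N * m.
have L1 : 1 <= L.
  by rewrite /L -!addrA lerDl !addr_ge0 ?mulr_ge0 // ?(ltW K0) ?(ltW m0).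
have L0 : 0 < L := lt_le_trans ltr01 L1.
pose r := rho / L.
have rL : r * L = rho by rewrite /r divfK // gt_eqF.
have r0 : 0 < r by rewrite divr_gt0.
exists r, (K1 + K2 * (K * m ^+ 2)); split=> //.
  by rewrite addr_ge0 // (mulr_ge0 K20) // (mulr_ge0 (ltW K0)) ?sqr_ge0.
move=> T V i T0T isoT frV pi; have [symT triT specT] := isoT.
set b := subdiag_last T.
have br : `|b| < r.
  apply: le_lt_trans T0T; have := mx_entry_le_norm (T0 - T) ord_max pen.
  by rewrite !mxE -/(subdiag_last T0) b0 sub0r normrN.
pose d := m * `|b|.
have d0 : 0 <= d by rewrite mulr_ge0 // ltW.
have bd : `|b| <= d by rewrite ler_peMl.
have Nd : 2 * (N * d) < rho.
  have -> : 2 * (N * d) = 2 * N * m * `|b| by rewrite /d; ring.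
  have Nm : 0 < 2 * N * m by rewrite !mulr_gt0.
  rewrite -rL; apply: (@lt_le_trans _ _ (2 * N * m * r)); first by rewrite ltr_pM2l.
  rewrite mulrC ler_wpM2l ?(ltW r0) // /L lerDr.
  by rewrite !addr_ge0 // mulr_ge0 // ltW.
have rho1 : rho <= 1 by rewrite !ge_min lexx !orbT.
have d1 : d <= 2^-1.
  have : 1 * d <= N * d by rewrite ler_wpM2r.
  lra.
have d2d : d ^+ 2 <= d by rewrite expr2 ler_piMr //; lra.
have Nd2 : N * d ^+ 2 <= 3 / 4.
  have : N * d ^+ 2 <= N * d by rewrite ler_wpM2l //; lra.
  lra.
have defect : 1 - d ^+ 2 <= V ord_max i ^+ 2.
  exact: (last_weight_near1 gap0 gapP triT frV pi).
have [T1 [isoT1 b1 c1 bT1]] := retr T V i d isoT frV d0 bd Nd2 defect.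
have [symT1 triT1 _] := isoT1.
have sigmaT1 : sigma T1 = lam 0 i.
  have [j []] := sigmaC T1 isoT1; rewrite b1 normr0 !mulr0 c1 !normr_le0 !subr_eq0.
  by move=> /eqP -> /eqP ->.
pose M := T - b *: last_coupling.
have MT : M + b *: last_coupling = T by rewrite subrK.
have ME : M - b *: last_coupling =
    last_sign n.+2 (-1) *m T *m last_sign n.+2 (-1).
  by rewrite last_sign_conj // /M -/b mulr2n mulrDl mul1r scalerDl opprD addrA.
have isoE := last_sign_isospectral incr isoT.
have near0 X c : `|X| <= c * `|b| -> 0 <= c -> 1 + c <= L -> `|T0 - (T + X)| < rho.
  move=> Xc c0 cL; rewrite opprD addrA (le_lt_trans (ler_normB _ _)) //.
  rewrite -rL (lt_le_trans (y := r * (1 + c))) ?ler_wpM2l ?(ltW r0) //.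
  rewrite mulrDr mulr1 ltr_leD // (le_trans Xc) // mulrC ler_wpM2r //.
  exact: ltW.
have rhoP X : `|T0 - X| < rho -> [/\ `|T0 - X| < r1, `|T0 - X| < r2 & `|T0 - X| < r3].
  by rewrite !lt_min => /andP[/andP[-> ->] /andP[-> _]].
have Km0 : 0 <= K * m by rewrite mulr_ge0 ?(ltW K0) ?(ltW m0).
have Nm0 : 0 <= 2 * N * m by rewrite !mulr_ge0 ?(ltW N0) ?(ltW m0).
have nearT : `|T0 - T| < rho.
  by rewrite -[T]addr0; apply: (near0 0 0); rewrite ?normr0 ?mul0r // addr0.
have nearM : `|T0 - M| < rho.
  apply: (near0 _ B) => //; first by rewrite normrN normrZ mulrC.
  by rewrite /L; lra.
have nearE : `|T0 - (M - b *: last_coupling)| < rho.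
  rewrite /M -addrA; apply: (near0 _ (2 * B)); rewrite ?mulr_ge0 //.
    rewrite -opprD normrN (le_trans (ler_normD _ _)) // normrZ -/B; lra.
  by rewrite /L; lra.
have nearT1 : `|T0 - T1| < rho.
  rewrite (_ : T1 = T + (T1 - T)); last by rewrite addrC subrK.
  apply: (near0 _ (K * m)) => //; last by rewrite /L; lra.
  apply: mx_norm_le => [|j k]; first by rewrite mulr_ge0.
  apply: le_trans (bT1 j k) _; rewrite -mulrA ler_wpM2l ?(ltW K0) //.
  by case: ifP.
have [T_1 T_2 T_3] := rhoP _ nearT; have [M_1 M_2 _] := rhoP _ nearM.
have [_ _ E_3] := rhoP _ nearE; have [_ T1_2 T1_3] := rhoP _ nearT1.
have r_r1 : `|b| < r1.
  rewrite (lt_le_trans br) // (@le_trans _ _ rho) //; last by rewrite !ge_min lexx.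
  by rewrite -rL ler_peMr // ltW.
have gTM : `|sigma T - g M| <= K1 * b ^+ 2.
  rewrite -gsigma // -{1}MT; apply: even_g => //.
  rewrite MT gsigma // gsigma ME //; last by rewrite -ME.
  by rewrite sigmaE //; exact: last_sign_diagonal.
have MT1 : `|M - T1| <= K * m ^+ 2 * b ^+ 2.
  have rowmax k : k != ord_max -> (M - T1) ord_max k = 0.
    move=> km; rewrite !mxE -/(last_coupling ord_max k).
    have -> : T1 ord_max k = 0.
      by have [->|kp] := eqVneq k pen; [exact: b1|exact: tridiagonal_last].
    have := last_coupling_max k; rewrite !mxE => ->.
    have [->|kp] := eqVneq k pen; first by rewrite mulr1 subrr subr0.
    by rewrite tridiagonal_last // mulr0 !subr0.
  have symMT1 : (M - T1)^T = M - T1.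
    by rewrite /M 2!linearB linearZ /= last_coupling_tr symT symT1.
  have c0 : 0 <= K * m ^+ 2 * b ^+ 2 by rewrite -mulrA (mulr_ge0 (ltW K0)) // mulr_ge0 ?sqr_ge0.
  have bE : K * m ^+ 2 * b ^+ 2 = K * d ^+ 2.
    by rewrite /d exprMn real_normK ?num_real // -mulrA.
  apply: mx_norm_le => // j k.
  have diag_block : last_coupling j k = 0 -> (j == ord_max) = (k == ord_max) ->
      `|(M - T1) j k| <= K * m ^+ 2 * b ^+ 2.
    move=> B_0 jk; have ME_jk : M j k = T j k.
      by rewrite 3!mxE B_0 mulr0 subr0.
    have := bT1 j k; rewrite mxE [(- T) j k]mxE jk eqxx -bE => bT1_jk.
    by rewrite mxE [(- T1) j k]mxE ME_jk distrC.
  have [jm|jm] := eqVneq j ord_max; have [km|km] := eqVneq k ord_max.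
  - apply: diag_block; last by rewrite jm km.
    by rewrite jm km last_coupling_max eq_sym (negbTE (@pen_neq_max n)).
  - by rewrite jm rowmax ?normr0.
  - by rewrite -symMT1 mxE km rowmax ?normr0.
  - by apply: diag_block; rewrite ?last_coupling0 // (negbTE jm) (negbTE km).
have := lip_g M T1 M_2 T1_2; rewrite (gsigma T1) // sigmaT1 => gMT1.
rewrite -[sigma T - _](subrKA (g M)) (le_trans (ler_normD _ _)) // mulrDl lerD //.
by apply: le_trans gMT1 _; rewrite -mulrA ler_wpM2l.
Qed.

End QuadraticShift.

(** * One step in a deflation neighborhood *)

Section Spacing.
Variables (R : realType) (n : nat).
Implicit Types (lam : 'rV[R]_n).

Lemma eigenvalue_gap lam : increasing lam ->
  exists gap : R, 0 < gap /\ forall i j, i != j -> gap <= `|lam 0 i - lam 0 j|.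
Proof.
move=> incr; exists (\big[Num.min/1]_(p : 'I_n * 'I_n | p.1 != p.2)
  `|lam 0 p.1 - lam 0 p.2|); split=> [|i j ij].
  apply: lt_bigmin => // p pp; rewrite normr_gt0 subr_eq0.
  by apply: contra pp => /eqP/(increasing_inj incr) ->.
exact: (bigmin_le_cond 1 (fun p : 'I_n * 'I_n => `|lam 0 p.1 - lam 0 p.2|)
  (j := (i, j))).
Qed.

(** Two eigenvalues at the same minimal distance from [lam i] lie on both
    sides of it, hence are its neighbors, and form with it a progression of
    three consecutive eigenvalues. *)
Lemma closest_eigenvalue lam (i i' : 'I_n) : increasing lam -> i' != i ->
  ~ strong_ap (diag_mx lam) -> exists2 m, m != i & forall j, j != i -> j != m ->
    `|lam 0 m - lam 0 i| < `|lam 0 j - lam 0 i|.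
Proof.
move=> incr i'i notap.
have [m mi mmin] := arg_minP (P := fun j => j != i) (fun j => `|lam 0 j - lam 0 i|) i'i.
exists m => // j ji jm; rewrite lt_neqAle mmin // andbT.
apply/negP => /eqP distE; apply: notap; exists lam; split.
  split=> //; apply: (@eigenframe_spectrum _ _ _ _ 1%:M).
  by split; rewrite ?trmx1 mulmx1 ?mul1mx.
have nsub (p q : 'I_n) : `|lam 0 p - lam 0 i| = `|lam 0 q - lam 0 i| ->
    (forall k, k != i -> `|lam 0 p - lam 0 i| <= `|lam 0 k - lam 0 i|) ->
    (p < i)%N -> (i < q)%N -> [/\ i = p.+1 :> nat, q = i.+1 :> nat &
      lam 0 i - lam 0 p = lam 0 q - lam 0 i].
  move=> pq pmin pi iq; have lpi := incr _ _ pi; have liq := incr _ _ iq.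
  rewrite ler0_norm ?subr_le0 ?(ltW lpi) // ger0_norm ?subr_ge0 ?(ltW liq) // in pq.
  rewrite ler0_norm ?subr_le0 ?(ltW lpi) // in pmin.
  have between k : k != i -> ~ (p < k < q)%N.
    move=> ki /andP[/incr pk /incr kq]; have := pmin k ki.
    by rewrite ler_normr => /orP[]; lra.
  split; last by rewrite -pq opprB.
  - apply/eqP; rewrite eqn_leq pi andbT leqNgt; apply/negP => p1.
    have p1n := ltn_trans p1 (ltn_ord i).
    apply: (between (Ordinal p1n)) => /=.
      by rewrite -val_eqE /= neq_ltn p1.
    by rewrite ltnSn (ltn_trans p1 iq).
  - apply/eqP; rewrite eqn_leq iq andbT leqNgt; apply/negP => i1.
    have i1n := ltn_trans i1 (ltn_ord q).
    apply: (between (Ordinal i1n)) => /=.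
      by rewrite -val_eqE /= neq_ltn ltnSn orbT.
    by rewrite i1 andbT (ltn_trans pi (ltnSn i)).
have same_side (p q : 'I_n) : (0 <= lam 0 p - lam 0 i) = (0 <= lam 0 q - lam 0 i) ->
    `|lam 0 p - lam 0 i| = `|lam 0 q - lam 0 i| -> p = q.
  move=> s d; apply: (increasing_inj incr); apply: (subIr (lam 0 i)).
  case: (lerP 0 (lam 0 p - lam 0 i)) s d => pi /esym qi.
    by rewrite !ger0_norm.
  move/negbT: qi; rewrite -ltNge => qi.
  by rewrite !ltr0_norm // => /oppr_inj.
have lt_lam (p q : 'I_n) : (lam 0 p < lam 0 q) = (p < q)%N.
  case: (ltngtP p q) => [/incr -> //|/incr /ltW|/val_inj ->]; last exact: ltxx.
  by move=> h; apply/negbTE; rewrite -leNgt.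
have [mlti|] := ltnP m i.
  have ilej : (i < j)%N.
    case: (ltngtP i j) => // [jlti|/val_inj e]; last by rewrite e eqxx in ji.
    case/negP: jm; apply/eqP; symmetry; apply: same_side => //.
    by rewrite !subr_ge0 !leNgt !lt_lam mlti jlti.
  have [h1 h2 h3] := nsub m j distE mmin mlti ilej.
  by exists m, i, j; split.
rewrite leq_eqVlt => /predU1P[/val_inj e|iltm]; first by rewrite e eqxx in mi.
have jlti : (j < i)%N.
  case: (ltngtP j i) => // [iltj|/val_inj e]; last by rewrite e eqxx in ji.
  case/negP: jm; apply/eqP; symmetry; apply: same_side => //.
  by rewrite !subr_ge0 !leNgt !lt_lam !ltnNge (ltnW iltm) (ltnW iltj).
have jmin k : k != i -> `|lam 0 j - lam 0 i| <= `|lam 0 k - lam 0 i|.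
  by move=> ki; rewrite -distE mmin.
have [h1 h2 h3] := nsub j m (esym distE) jmin jlti iltm.
by exists j, i, m; split.
Qed.

End Spacing.

Definition accurate_shift (R : realType) (n : nat) (lam : 'rV[R]_n.+3)
    (sigma : 'M[R]_n.+3 -> R) (C : R) : Prop :=
  forall T, isospectral lam T ->
    exists i, `|sigma T - lam 0 i| <= C * `|subdiag_last T| /\
      `|T ord_max ord_max - lam 0 i| <= Num.sqrt 2 * `|subdiag_last T|.

Section Step.
Variables (R : realType) (n : nat) (lam : 'rV[R]_n.+3) (sigma : 'M[R]_n.+3 -> R).
Variables (gap C : R).
Implicit Types (T V : 'M[R]_n.+3).

Hypothesis incr : increasing lam.
Hypothesis gapP : forall i j, i != j -> gap <= `|lam 0 i - lam 0 j|.
Hypothesis sigmaP : accurate_shift lam sigma C.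
Hypothesis gap_gt0 : 0 < gap.
Hypothesis C_gt0 : 0 < C.

(** Small enough for the shift to stay within [gap / 8] of the eigenvalue, for
    the last weight to exceed [3 / 4] and for [b] to be halved by each step. *)
Definition deflation_radius : R := gap / (8 * (C + 1)).
Local Notation eps := deflation_radius.

Lemma deflation_radius_gt0 : 0 < eps.
Proof. by rewrite divr_gt0 // mulr_gt0 // addr_gt0. Qed.

Lemma deflation_radius_le : eps <= gap / 8.
Proof.
rewrite /eps ler_pdivrMr ?mulr_gt0 ?addr_gt0 //.
by have := mulr_gt0 gap_gt0 C_gt0; lra.
Qed.

Lemma deflation_radius_C : C * eps <= gap / 8.
Proof.
rewrite /eps mulrA ler_pdivrMr ?mulr_gt0 ?addr_gt0 //.
by have := gap_gt0; rewrite [leRHS](_ : _ = gap * C + gap); [lra|field].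
Qed.

(** As the squares of the last components sum to [1], the bound [3 / 4] singles
    out [i]. *)
Definition deflating (i : 'I_n.+3) T V : Prop :=
  [/\ deflation lam eps T, eigenframe lam T V & 3 / 4 <= V ord_max i ^+ 2].

Lemma defect_small (p b S : R) : `|b| <= eps -> S <= 3 * b ^+ 2 ->
  (1 - p) * gap ^+ 2 <= S -> 3 / 4 <= p.
Proof.
move=> be Sb pS; have g2 : 0 < gap ^+ 2 by rewrite exprn_gt0.
have : b ^+ 2 <= (gap / 8) ^+ 2.
  rewrite -(real_normK (num_real b)) ler_pXn2r ?nnegrE ?divr_ge0 ?(ltW gap_gt0) //.
  exact: le_trans be deflation_radius_le.
have -> : (gap / 8) ^+ 2 = gap ^+ 2 / 64 by field.
move=> b2; rewrite leNgt; apply/negP => p34.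
have : gap ^+ 2 / 4 < (1 - p) * gap ^+ 2.
  by rewrite mulrC ltr_pM2r //; lra.
by lra.
Qed.

Lemma deflating_exists T V : deflation lam eps T -> eigenframe lam T V ->
  exists i, deflating i T V /\ `|sigma T - lam 0 i| <= C * `|subdiag_last T|.
Proof.
move=> defT frV; have [isoT be] := defT; have [_ triT _] := isoT.
have [i [si ci]] := sigmaP isoT; exists i; split=> //; split=> //.
apply: (defect_small be _ (last_weight_defect gap_gt0 gapP i triT frV)).
have : (T ord_max ord_max - lam 0 i) ^+ 2 <= 2 * subdiag_last T ^+ 2.
  rewrite -[leLHS]real_normK ?num_real // -[X in _ <= _ * X]real_normK ?num_real //.
  have -> : 2 * `|subdiag_last T| ^+ 2 = (Num.sqrt 2 * `|subdiag_last T|) ^+ 2.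
    by rewrite exprMn sqr_sqrtr.
  by rewrite ler_pXn2r ?nnegrE ?mulr_ge0 // sqrtr_ge0.
lra.
Qed.

Lemma deflating_index i j T V : deflating i T V -> deflating j T V -> i = j.
Proof.
move=> [_ frV pi] [_ _ pj]; apply: contraTeq pj => ij.
have := orthogonal_row2 ord_max frV.1; rewrite (bigD1 i) //= (bigD1 j) 1?eq_sym //=.
set S := \sum_(_ | _) _; have S0 : 0 <= S by rewrite sumr_ge0 // => k _; rewrite sqr_ge0.
by rewrite -ltNge; lra.
Qed.

Lemma deflating_shift i T V : deflating i T V ->
  `|sigma T - lam 0 i| <= C * `|subdiag_last T|.
Proof.
move=> dT; have [defT frV _] := dT.
by have [j [dTj sj]] := deflating_exists defT frV; rewrite (deflating_index dT dTj).
Qed.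

Lemma deflating_shift_gap i T V : deflating i T V ->
  `|lam 0 i - sigma T| <= gap / 8.
Proof.
move=> dT; have [[_ be] _ _] := dT; rewrite distrC.
apply: le_trans (deflating_shift dT) _; apply: le_trans deflation_radius_C.
by rewrite ler_wpM2l // ltW.
Qed.

Lemma step_isospectral s T : isospectral lam T -> almost_invertible (T - s%:M) ->
  isospectral lam (step s T).
Proof.
move=> [symT triT specT] aiT; have [V frV] := eigenframe_exists incr symT specT.
have [U QU] := Q_star_spec aiT; have [_ orthQ _ _] := QU.
have frF := conj_eigenframe orthQ frV.
split; [exact: eigenframe_sym frF| |exact: eigenframe_spectrum frF].
apply: (conj_tridiagonal symT triT _ QU).
by rewrite mulmxBl mulmxBr scalar_mxC.
Qed.

Definition step_frame T V : 'M[R]_n.+3 := (Q_star (T - (sigma T)%:M))^T *m V.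

Lemma deflating_defined i T V : deflating i T V -> step_defined sigma T.
Proof.
move=> dT; have [[isoT be] frV pi] := dT.
apply: (shift_almost_invertible (i := i) frV).
  by apply: contraTneq pi => ->; rewrite expr0n -ltNge /=; lra.
move=> j ji; apply/eqP => e; have := deflating_shift_gap dT.
by rewrite -e distrC; have := gapP ji; have := gap_gt0; lra.
Qed.

(** The moment about [lam i] bounded by [step_contraction] controls both the
    new [b] and the new last weight, so that the index [i] persists. *)
Lemma deflating_step i T V : deflating i T V ->
  [/\ deflating i (shifted_step sigma T) (step_frame T V),
      `|subdiag_last (shifted_step sigma T)| <= 2^-1 * `|subdiag_last T|,
      `|subdiag_last (shifted_step sigma T)| <=
         4 / gap * `|sigma T - lam 0 i| * `|subdiag_last T| &
      exists rho, forall j, (lam 0 j - sigma T) * step_frame T V ord_max j =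
        rho * V ord_max j].
Proof.
move=> dT; have [[isoT be] frV pi] := dT; have [symT triT specT] := isoT.
have aiT := deflating_defined dT; have si := deflating_shift_gap dT.
have [U QU] := Q_star_spec aiT; have [_ orthQ _ _] := QU.
have frF := conj_eigenframe orthQ frV.
have isoF : isospectral lam (shifted_step sigma T) by exact: step_isospectral.
have [symF triF specF] := isoF.
have pi2 : 2^-1 <= V ord_max i ^+ 2 by apply: le_trans pi; lra.
have contr := step_contraction gap_gt0 gapP triT frV QU triF pi2.
have {}contr := contr (le_trans si (_ : gap / 8 <= gap / 2)).
have /contr {}contr : gap / 8 <= gap / 2 by have := gap_gt0; lra.
rewrite -/(step (sigma T) T) -/(shifted_step sigma T) in contr frF.
rewrite -/(step_frame T V) in frF.
set b := subdiag_last T in be contr *; set F := shifted_step sigma T in contr frF isoF *.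
set b' := subdiag_last F in contr *.
have b'le : `|b'| <= 4 / gap * `|sigma T - lam 0 i| * `|b|.
  rewrite -(@ler_pXn2r _ 2) ?nnegrE ?mulr_ge0 ?invr_ge0 ?(ltW gap_gt0) //.
  rewrite !exprMn !real_normK ?num_real // exprVn.
  have -> : 4 ^+ 2 / gap ^+ 2 * (sigma T - lam 0 i) ^+ 2 * b ^+ 2 =
      16 / gap ^+ 2 * (lam 0 i - sigma T) ^+ 2 * b ^+ 2 :> R.
    by field; rewrite gt_eqF.
  by apply: le_trans contr; rewrite lerDr sqr_ge0.
have half : `|b'| <= 2^-1 * `|b|.
  apply: le_trans b'le _; rewrite ler_wpM2r // distrC.
  rewrite -ler_pdivlMl ?divr_gt0 //; apply: le_trans si _.
  by rewrite le_eqVlt; apply/orP; left; apply/eqP; field; rewrite gt_eqF.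
have b'e : `|b'| <= eps by have := normr_ge0 b; lra.
split=> //; last first.
  exists (U ord_max ord_max) => j.
  have MV : (T - (sigma T)%:M) *m V = V *m diag_mx (lam - const_mx (sigma T)).
    rewrite linearB /= diag_const_mx mulmxBl mulmxBr frV.2.
    by rewrite mul_scalar_mx mul_mx_scalar.
  by rewrite -(conj_last_row MV QU) !mxE.
split=> //.
apply: (@defect_small _ b _ be _ (last_weight_defect gap_gt0 gapP i triF frF)).
apply: le_trans contr _; rewrite ler_wpM2r ?sqr_ge0 //.
have : (lam 0 i - sigma T) ^+ 2 <= (gap / 8) ^+ 2.
  rewrite -[leLHS]real_normK ?num_real // ler_pXn2r ?nnegrE ?divr_ge0 ?(ltW gap_gt0) //.
have -> : (gap / 8) ^+ 2 = gap ^+ 2 / 64 by field.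
move=> h; rewrite mulrAC ler_pdivrMr ?exprn_gt0 //.
by have := sqr_ge0 gap; lra.
Qed.

Lemma deflation_invariant : invariant_under sigma (deflation lam eps).
Proof.
move=> T defT; have [[symT _ specT] _] := defT.
have [V frV] := eigenframe_exists incr symT specT.
have [i [dT _]] := deflating_exists defT frV.
by split; [exact: deflating_defined dT|case: (deflating_step dT) => [[]]].
Qed.

End Step.

(** * Sequences *)

Section Sequences.
Variable R : realType.

Lemma geometric_decay (u : nat -> R) (q : R) K : 0 <= q < 1 ->
  (forall k, 0 <= u k) -> (forall k, (K <= k)%N -> u k.+1 <= q * u k) ->
  u @ \oo --> (0 : R).
Proof.
move=> /andP[q0 q1] u0 uq; rewrite -(cvg_shiftn K).
have uK k : u (k + K)%N <= geometric (u K) q k.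
  elim: k => [|k IH]; first by rewrite /geometric /= expr0 mulr1.
  apply: le_trans (uq _ (leq_addl _ _)) _.
  by rewrite /geometric /= exprS mulrCA ler_wpM2l.
apply: (@squeeze_cvgr _ _ _ _ (fun=> 0) (geometric (u K) q)).
- by near=> k; rewrite u0 uK.
- exact: cvg_cst.
- by apply: cvg_geometric; rewrite ger0_norm.
Unshelve. all: by end_near. Qed.

Lemma increasing_seq_ge (f : nat -> nat) :
  {homo f : m n / (m < n)%N} -> forall l, (l <= f l)%N.
Proof.
by move=> fh; elim=> // l /leq_ltn_trans; apply; exact: fh.
Qed.

Lemma subseq_cvg (T : Type) (F : set_system T) (u : nat -> T) (f : nat -> nat) :
  (forall l, (l <= f l)%N) -> u @ \oo --> F -> (u \o f) @ \oo --> F.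
Proof.
move=> fge uF A FA; have [N _ NA] := uF A FA.
by exists N => // l Nl; apply: NA; exact: leq_trans Nl (fge l).
Qed.

(** Subsequences are extracted for one index after the other; those already
    obtained keep converging. *)
Lemma joint_subsequence (I : finType) (u : I -> nat -> R) (M : R) :
  (forall i k, `|u i k| <= M) ->
  exists2 f : nat -> nat, {homo f : m n / (m < n)%N} &
    exists l : I -> R, forall i, (u i \o f) @ \oo --> l i.
Proof.
move=> uM; suff [f fh fc] : exists2 f : nat -> nat, {homo f : m n / (m < n)%N} &
    forall i, i \in enum I -> cvgn (u i \o f).
  exists f => //; exists (fun i => lim ((u i \o f) @ \oo)) => i.
  by apply: fc; rewrite mem_enum.
elim: (enum I) => [|i s [f fh fs]]; first by exists id.
have [|g gi gc] := bolzano_weierstrass (u_ := u i \o f).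
  by exists M; split=> [|x Mx k _ /=]; [exact: num_real|rewrite (le_trans (uM _ _)) // ltW].
have gh : {homo g : m n / (m < n)%N}.
  by move=> m p; rewrite !ltnNge -!leEnat gi.
exists (f \o g) => [m p mp /=|j]; first exact/fh/gh.
rewrite inE => /predU1P[-> //|/fs/cvg_ex[l lc]].
by apply/cvg_ex; exists l; exact: (subseq_cvg (increasing_seq_ge gh) lc).
Qed.

Definition entrywise_cvg m n (A : nat -> 'M[R]_(m, n)) (L : 'M[R]_(m, n)) : Prop :=
  forall i j, (fun k => A k i j) @ \oo --> L i j.

Lemma entrywise_cvg_mul m n p (A : nat -> 'M[R]_(m, n)) (B : nat -> 'M[R]_(n, p))
    L M : entrywise_cvg A L -> entrywise_cvg B M ->
  entrywise_cvg (fun k => A k *m B k) (L *m M).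
Proof.
move=> AL BM i j; rewrite mxE.
rewrite (_ : (fun k => _) = (fun k => \sum_l A k i l * B k l j)); last first.
  by apply/funext => k; rewrite mxE.
apply: cvg_big => [|l _]; first exact: add_continuous.
exact: cvgM (AL i l) (BM l j).
Qed.

Lemma entrywise_cvg_tr m n (A : nat -> 'M[R]_(m, n)) L :
  entrywise_cvg A L -> entrywise_cvg (fun k => (A k)^T) L^T.
Proof.
move=> AL i j; rewrite mxE (_ : (fun k => _) = (fun k => A k j i)) //.
by apply/funext => k; rewrite mxE.
Qed.

Lemma entrywise_cvg_cst m n (L : 'M[R]_(m, n)) : entrywise_cvg (fun=> L) L.
Proof. by move=> i j; exact: cvg_cst. Qed.

Lemma entrywise_cvg_unique m n (A : nat -> 'M[R]_(m, n)) L M :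
  entrywise_cvg A L -> entrywise_cvg A M -> L = M.
Proof.
by move=> AL AM; apply/matrixP => i j; exact: (cvg_unique _ (AL i j) (AM i j)).
Qed.

Lemma entrywise_cvg_near m n (A : nat -> 'M[R]_(m, n)) L r :
  entrywise_cvg A L -> 0 < r -> \forall k \near \oo, `|L - A k| < r.
Proof.
move=> AL r0; have r20 : 0 < r / 2 by rewrite divr_gt0.
have : \forall k \near \oo, forall ij : 'I_m * 'I_n,
    `|L ij.1 ij.2 - A k ij.1 ij.2| <= r / 2.
  apply: (@filter_forall _ _ (fun (ij : 'I_m * 'I_n) k =>
    `|L ij.1 ij.2 - A k ij.1 ij.2| <= r / 2) \oo) => ij.
  by have /cvgr_dist_le/(_ _ r20) := AL ij.1 ij.2.
apply: filterS => k kr; apply: (@le_lt_trans _ _ (r / 2)); last lra.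
by apply: mx_norm_le => [|i j]; [exact: ltW|rewrite !mxE (kr (i, j))].
Qed.

End Sequences.

(** * Orbits of the iteration *)

Section Orbit.
Variables (R : realType) (n : nat) (lam : 'rV[R]_n.+3) (sigma : 'M[R]_n.+3 -> R).
Variables (gap C : R) (i : 'I_n.+3) (T V : 'M[R]_n.+3).

Local Notation pen := (inord n.+1 : 'I_n.+3).
Local Notation ante := (inord n : 'I_n.+3).

Hypothesis incr : increasing lam.
Hypothesis gapP : forall i j, i != j -> gap <= `|lam 0 i - lam 0 j|.
Hypothesis sigmaP : accurate_shift lam sigma C.
Hypothesis gap_gt0 : 0 < gap.
Hypothesis C_gt0 : 0 < C.
Hypothesis deflT : deflating lam gap C i T V.

Definition orbit (k : nat) : 'M[R]_n.+3 := iter k (shifted_step sigma) T.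

(** The eigenvectors are transported by the rotations of the steps, which fixes
    their signs along the orbit. *)
Fixpoint orbit_frame (k : nat) : 'M[R]_n.+3 :=
  if k is k'.+1 then step_frame sigma (orbit k') (orbit_frame k') else V.

Local Notation b k := (subdiag_last (orbit k)).
Local Notation w k := (orbit_frame k ord_max).
Local Notation y k := (orbit_frame k pen).
Local Notation shift k := (sigma (orbit k)).

Lemma orbit_deflating k : deflating lam gap C i (orbit k) (orbit_frame k).
Proof.
elim: k => //= k IH; by have [] := deflating_step incr gapP sigmaP gap_gt0 C_gt0 IH.
Qed.

Lemma orbit_half k : `|b k.+1| <= 2^-1 * `|b k|.
Proof. by have [] := deflating_step incr gapP sigmaP gap_gt0 C_gt0 (orbit_deflating k). Qed.

Lemma orbit_contraction k :
  `|b k.+1| <= 4 / gap * `|shift k - lam 0 i| * `|b k|.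
Proof. by have [] := deflating_step incr gapP sigmaP gap_gt0 C_gt0 (orbit_deflating k). Qed.

Lemma orbit_weights k : exists rho, forall j,
  (lam 0 j - shift k) * w k.+1 j = rho * w k j.
Proof. by have [] := deflating_step incr gapP sigmaP gap_gt0 C_gt0 (orbit_deflating k). Qed.

Lemma orbit_cvg0 : (fun k => b k) @ \oo --> (0 : R).
Proof.
apply: norm_cvg0; apply: (@geometric_decay _ _ 2^-1 0) => [||k _].
- by apply/andP; split; lra.
- by move=> k; exact: normr_ge0.
- exact: orbit_half.
Qed.

Lemma orbit_shift_cvg : (fun k => `|shift k - lam 0 i|) @ \oo --> (0 : R).
Proof.
apply: (@squeeze_cvgr _ _ _ _ (fun=> 0) (fun k => C * `|b k|)).
- apply: nearW => k; rewrite normr_ge0.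
  exact: (deflating_shift gapP sigmaP gap_gt0 C_gt0 (orbit_deflating k)).
- exact: cvg_cst.
- have := cvgM (cvg_cst C) (cvg_norm orbit_cvg0).
  by rewrite normr0 mulr0; exact.
Qed.

Lemma orbit_vanish k k' : (k <= k')%N -> b k = 0 -> b k' = 0.
Proof.
move=> /subnK <- bk; elim: (k' - k)%N => [|d IH] //.
have := orbit_half (d + k); rewrite IH normr0 mulr0 => h.
by apply/normr0_eq0/eqP; rewrite eq_le h normr_ge0.
Qed.

Section Dominance.
Variable m : 'I_n.+3.
Hypothesis mi : m != i.
Hypothesis closest : forall j, j != i -> j != m ->
  `|lam 0 m - lam 0 i| < `|lam 0 j - lam 0 i|.
Hypothesis w0 : forall j, V ord_max j != 0.
Hypothesis b_neq0 : forall k, b k != 0.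

(** A vanishing pivot [rho] would put the shift on [lam i] and make the next
    [b] zero. *)
Lemma orbit_weight_neq0 k j : w k j != 0.
Proof.
elim: k j => [|k IH] j //=; have [rho E] := orbit_weights k.
have rho0 : rho != 0.
  apply: contra (b_neq0 k.+1) => /eqP rho0.
  have wi' : w k.+1 i != 0.
    have [_ _ h] := orbit_deflating k.+1.
    by apply: contraTneq h => ->; rewrite expr0n -ltNge /=; lra.
  have /eqP := E i; rewrite rho0 mul0r mulf_eq0 (negbTE wi') orbF subr_eq0 => /eqP si.
  have := orbit_contraction k; rewrite -si subrr normr0 mulr0 mul0r => h.
  by rewrite -normr_eq0 eq_le h normr_ge0.
apply: contraTneq isT => wj'; have /eqP := E j.
by rewrite wj' mulr0 eq_sym mulf_eq0 (negbTE rho0) (negbTE (IH j)).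
Qed.

(** Each step multiplies [w_j / w_m] by [(lam_m - s) / (lam_j - s)], whose
    absolute value tends to [dm / dj < 1]. *)
Lemma weight_ratio_cvg0 j : j != i -> j != m ->
  (fun k => `|w k j| / `|w k m|) @ \oo --> (0 : R).
Proof.
move=> ji jm; set dm := `|lam 0 m - lam 0 i|; set dj := `|lam 0 j - lam 0 i|.
have dmj : dm < dj by exact: closest.
have dm0 : 0 <= dm by exact: normr_ge0.
pose e := (dj - dm) / 4; have e0 : 0 < e by rewrite divr_gt0 // subr_gt0.
have [K _ KP] : \forall k \near \oo, `|shift k - lam 0 i| <= e.
  have /cvgr_dist_le/(_ e e0) := orbit_shift_cvg.
  by apply: filterS => k; rewrite sub0r normrN normr_id.
have d0 : 0 < dm + 3 * e by lra.
apply: (@geometric_decay _ _ ((dm + e) / (dm + 3 * e)) K).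
- rewrite divr_ge0 //=; [|lra|lra].
  by rewrite ltr_pdivrMr // mul1r; lra.
- by move=> k; rewrite divr_ge0.
- move=> k /KP /= sk; have [rho E] := orbit_weights k.
  have wm := orbit_weight_neq0 k m; have wm' := orbit_weight_neq0 k.+1 m.
  have E' : `|lam 0 j - shift k| * `|w k.+1 j| * `|w k m| =
      `|lam 0 m - shift k| * `|w k j| * `|w k.+1 m|.
    by rewrite -!normrM E mulrAC [in RHS]mulrAC E mulrAC.
  have hj : dm + 3 * e <= `|lam 0 j - shift k|.
    have := ler_normD (lam 0 j - shift k) (shift k - lam 0 i).
    by rewrite addrA subrK -/dj /e in sk *; lra.
  have hm : `|lam 0 m - shift k| <= dm + e.
    have := ler_normD (lam 0 m - lam 0 i) (lam 0 i - shift k).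
    by rewrite addrA subrK [`|lam 0 i - shift k|]distrC -/dm; lra.
  have -> : (dm + e) / (dm + 3 * e) * (`|w k j| / `|w k m|) =
      (dm + e) * `|w k j| / ((dm + 3 * e) * `|w k m|).
    by field; rewrite normr_eq0 wm gt_eqF.
  rewrite ler_pdivrMr ?normr_gt0 // mulrAC ler_pdivlMr ?mulr_gt0 ?normr_gt0 //.
  apply: (@le_trans _ _ (`|lam 0 j - shift k| * `|w k.+1 j| * `|w k m|)).
    by rewrite mulrA ler_wpM2r // mulrC ler_wpM2r.
  by rewrite E' ler_wpM2r // ler_wpM2r.
Qed.

Lemma penultimate_row k j :
  b k * y k j = (lam 0 j - orbit k ord_max ord_max) * w k j.
Proof.
have [[[_ triT _] _] [_ TV] _] := orbit_deflating k.
have := sum_last (fun l => orbit_frame k l j) triT.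
have /matrixP/(_ ord_max j) := TV; rewrite mul_mx_diag [LHS]mxE [RHS]mxE => -> E.
by rewrite mulrBl [lam 0 j * _]mulrC E addrAC subrr add0r.
Qed.

(** By [penultimate_row] the ratio of two entries of the penultimate row is,
    up to bounded factors, that of the corresponding last components. *)
Lemma penultimate_cvg0 j : j != i -> j != m ->
  (fun k => y k j) @ \oo --> (0 : R).
Proof.
move=> ji jm; apply: norm_cvg0.
pose D := (`|lam 0 j - lam 0 i| + gap) / (gap / 2).
apply: (@squeeze_cvgr _ _ _ _ (fun=> 0) (fun k => D * (`|w k j| / `|w k m|))).
- apply: nearW => k; rewrite normr_ge0 /=.
  set c := orbit k ord_max ord_max.
  have [[isoT be] frV pi] := orbit_deflating k; have [_ triT _] := isoT.
  have cb : `|c - lam 0 i| <= gap / 8.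
    have pi2 : 2^-1 <= orbit_frame k ord_max i ^+ 2 by apply: le_trans pi; lra.
    have := diag_last_error triT frV pi2.
    rewrite -[leLHS]real_normK ?num_real // -[leRHS]real_normK ?num_real //.
    rewrite ler_pXn2r ?nnegrE // => /le_trans; apply; apply: le_trans be _.
    exact: deflation_radius_le.
  have hj : `|lam 0 j - c| <= `|lam 0 j - lam 0 i| + gap.
    have := ler_normD (lam 0 j - lam 0 i) (lam 0 i - c).
    by rewrite addrA subrK [`|lam 0 i - c|]distrC; have := gap_gt0; lra.
  have hm : gap / 2 <= `|lam 0 m - c|.
    have := ler_normD (lam 0 m - c) (c - lam 0 i).
    rewrite addrA subrK; have := gapP mi; have := gap_gt0; lra.
  have E : `|y k j| * (`|lam 0 m - c| * `|w k m|) =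
      `|y k m| * (`|lam 0 j - c| * `|w k j|).
    have bk0 : `|b k| != 0 by rewrite normr_eq0 b_neq0.
    apply: (mulfI bk0); rewrite -!normrM.
    by rewrite [in LHS]mulrA [in RHS]mulrA !penultimate_row -/c mulrC.
  have wm := orbit_weight_neq0 k m.
  have ym : `|y k m| <= 1 by exact: orthogonal_entry_le1 frV.1.
  have g2 : 0 < gap / 2 by rewrite divr_gt0.
  have -> : D * (`|w k j| / `|w k m|) =
      (`|lam 0 j - lam 0 i| + gap) * `|w k j| / (gap / 2 * `|w k m|).
    by rewrite /D; field; rewrite normr_eq0 wm gt_eqF.
  rewrite ler_pdivlMr ?mulr_gt0 ?normr_gt0 //.
  apply: (@le_trans _ _ (`|y k j| * (`|lam 0 m - c| * `|w k m|))).
    by rewrite ler_wpM2l // ler_wpM2r.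
  rewrite E; apply: (@le_trans _ _ (`|lam 0 j - c| * `|w k j|)).
    by rewrite ler_piMl // mulr_ge0.
  by rewrite ler_wpM2r.
- exact: cvg_cst.
- have := cvgM (cvg_cst D) (weight_ratio_cvg0 ji jm).
  by rewrite mulr0; exact.
Qed.

(** At a limit of eigenframes the last row is supported by [i] and the
    penultimate one by [m], so that both last couplings vanish. *)
Lemma orbit_limit_double_deflation (h : nat -> nat) V0 :
  (forall l, (l <= h l)%N) ->
  entrywise_cvg (fun l => orbit_frame (h l)) V0 ->
  let T0 := V0 *m diag_mx lam *m V0^T in
  entrywise_cvg (fun l => orbit (h l)) T0 /\ double_deflation lam T0.
Proof.
move=> hge cV T0.
have cT : entrywise_cvg (fun l => orbit (h l)) T0.
  have -> : (fun l => orbit (h l)) =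
      (fun l => orbit_frame (h l) *m diag_mx lam *m (orbit_frame (h l))^T).
    apply/funext => l; have [_ frV _] := orbit_deflating (h l).
    exact: eigenframeE.
  have cD := @entrywise_cvg_cst R _ _ (diag_mx lam).
  exact: entrywise_cvg_mul (entrywise_cvg_mul cV cD) (entrywise_cvg_tr cV).
split=> //.
have orthV0 : V0^T *m V0 = 1%:M.
  apply: (entrywise_cvg_unique (entrywise_cvg_mul (entrywise_cvg_tr cV) cV)).
  have -> : (fun l => (orbit_frame (h l))^T *m orbit_frame (h l)) = (fun=> 1%:M).
    by apply/funext => l; have [_ [orthV _] _] := orbit_deflating (h l).
  exact: entrywise_cvg_cst.
have frV0 : eigenframe lam T0 V0.
  by split=> //; rewrite /T0 -mulmxA orthV0 mulmx1.
have triT0 : tridiagonal T0.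
  move=> j k jk; apply: (cvg_unique (@Rhausdorff R) (cT j k)).
  have -> : (fun l => orbit (h l) j k) = (fun=> 0).
    apply/funext => l; have [[[_ triT _] _] _ _] := orbit_deflating (h l).
    exact: triT.
  exact: cvg_cst.
have isoT0 : isospectral lam T0.
  split=> //; [exact: eigenframe_sym frV0|exact: eigenframe_spectrum frV0].
have b0 : subdiag_last T0 = 0.
  exact: (cvg_unique _ (cT _ _) (subseq_cvg hge orbit_cvg0)).
have w0i : V0 ord_max i != 0.
  have : 3 / 4 <= V0 ord_max i ^+ 2.
    rewrite expr2; apply: (cvgr_to_ge (cvgM (cV ord_max i) (cV ord_max i))).
    by apply: nearW => l /=; rewrite -expr2; have [] := orbit_deflating (h l).
  by move=> h2; apply: contraTneq h2 => ->; rewrite expr0n -ltNge /=; lra.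
have rowT0 j : T0 ord_max ord_max * V0 ord_max j = lam 0 j * V0 ord_max j.
  have := sum_last (fun l => V0 l j) triT0; rewrite b0 mul0r addr0 => <-.
  have /matrixP/(_ ord_max j) := frV0.2; rewrite mul_mx_diag [LHS]mxE [RHS]mxE => ->.
  by rewrite mulrC.
have c0 : T0 ord_max ord_max = lam 0 i by exact: (mulIf w0i (rowT0 i)).
have w0j j : j != i -> V0 ord_max j = 0.
  move=> ji; have /eqP := rowT0 j; rewrite c0 -subr_eq0 -mulrBl mulf_eq0.
  case/orP => /eqP // /eqP; rewrite subr_eq0 => /eqP/(increasing_inj incr) e.
  by rewrite e eqxx in ji.
have y0j j : j != m -> V0 pen j = 0.
  move=> jm; have [->|ji] := eqVneq j i.
    have := orthogonal_row pen ord_max orthV0.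
    rewrite (negbTE (@pen_neq_max n)) (bigD1 i) //= big1 => [|l li].
      by rewrite addr0 => /eqP; rewrite mulf_eq0 (negbTE w0i) orbF => /eqP.
    by rewrite w0j ?mulr0.
  exact: (cvg_unique _ (cV _ _) (subseq_cvg hge (penultimate_cvg0 ji jm))).
split=> //.
have ortho : V0 pen m * V0 ante m = 0.
  have := orthogonal_row pen ante orthV0.
  rewrite eq_sym (negbTE (@ante_neq_pen n)) (bigD1 m) //= big1 ?addr0 // => l lm.
  by rewrite y0j ?mul0r.
rewrite /T0 mul_mx_diag mxE (bigD1 m) //= big1 => [|l lm].
  by rewrite !mxE addr0 mulrAC ortho mul0r.
by rewrite !mxE y0j // !mul0r.
Qed.

End Dominance.

End Orbit.

(** * Cubic convergence *)

(** By downward recursion on the rows of [T v = lambda v], an eigenvector of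
    an unreduced matrix with zero last coordinate is zero. *)
Lemma unreduced_last_neq0 (R : realType) n (lam : 'rV[R]_n.+1)
    (T V : 'M[R]_n.+1) j :
  tridiagonal T -> unreduced T -> eigenframe lam T V -> V ord_max j != 0.
Proof.
move=> triT unrT [orthV TV]; apply/eqP => Vj0.
suff V0 (d : nat) (k : 'I_n.+1) : (n - d <= k)%N -> V k j = 0.
  have := orthogonal_col2 j orthV; rewrite big1 => [/eqP|k _].
    by rewrite eq_sym oner_eq0.
  by rewrite (V0 n) ?subnn // expr0n.
elim: d k => [|d IH] k dk.
  rewrite (_ : k = ord_max) //; apply: val_inj => /=.
  by apply/eqP; rewrite subn0 in dk; rewrite eqn_leq dk andbT -ltnS.
have [dk'|kd] := leqP (n - d) k; first exact: IH.
have k1n : (k.+1 < n.+1)%N by rewrite ltnS (leq_trans kd) // leq_subr.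
pose p := Ordinal k1n.
have Vp (l : 'I_n.+1) : (k < l)%N -> V l j = 0.
  by move=> kl; apply: IH; move: dk kl; lia.
have /matrixP/(_ p j) := TV.
rewrite mul_mx_diag [LHS]mxE [RHS]mxE (Vp p (ltnSn k)) mul0r (bigD1 k) //= big1 => [/eqP|l lk].
  by rewrite addr0 mulf_eq0 (negbTE (unrT p k erefl)) => /eqP.
have [kl|lltk|/val_inj e] := ltngtP k l; first by rewrite Vp ?mulr0.
  by rewrite triT ?mul0r // ltnS lltk orbT.
by rewrite e eqxx in lk.
Qed.

Section Convergence.
Variables (R : realType) (n : nat) (lam : 'rV[R]_n.+3) (sigma : 'M[R]_n.+3 -> R).
Variables (gap C : R) (i m : 'I_n.+3) (T V : 'M[R]_n.+3).

Hypothesis incr : increasing lam.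
Hypothesis gapP : forall i j, i != j -> gap <= `|lam 0 i - lam 0 j|.
Hypothesis sigmaP : accurate_shift lam sigma C.
Hypothesis gap_gt0 : 0 < gap.
Hypothesis C_gt0 : 0 < C.
Hypothesis deflT : deflating lam gap C i T V.
Hypothesis mi : m != i.
Hypothesis closest : forall j, j != i -> j != m ->
  `|lam 0 m - lam 0 i| < `|lam 0 j - lam 0 i|.
Hypothesis w0 : forall j, V ord_max j != 0.
Hypothesis simple : simple_shift lam sigma.
Hypothesis smooth : double_deflation lam `&` singular_support lam sigma = set0.

Local Notation b k := (subdiag_last (orbit sigma T k)).

(** Otherwise, for each [N], the error of the shift exceeds [N * b ^+ 2] at some
    iterate beyond the [N]-th; such iterates accumulate at a doubly deflated
    matrix, against [quadratic_shift]. *)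
Lemma orbit_quadratic_shift : (forall k, b k != 0) ->
  exists A K, 0 <= A /\ forall k, (K <= k)%N ->
    `|sigma (orbit sigma T k) - lam 0 i| <= A * b k ^+ 2.
Proof.
move=> bn0; apply: contrapT => nocubic.
have /choice[h hP] (N : nat) : exists k, (N <= k)%N /\
    N%:R * b k ^+ 2 < `|sigma (orbit sigma T k) - lam 0 i|.
  apply: contrapT => noN; apply: nocubic; exists N%:R, N; split=> // k Nk.
  by rewrite leNgt; apply/negP => lt_k; apply: noN; exists k.
pose W k := orbit_frame sigma T V k.
have defl k : deflating lam gap C i (orbit sigma T k) (W k).
  exact: (orbit_deflating incr gapP sigmaP gap_gt0 C_gt0 deflT).
have frW k : eigenframe lam (orbit sigma T k) (W k) by have [] := defl k.
have [|f fh [l lc]] := joint_subsequence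
    (u := fun (ij : 'I_n.+3 * 'I_n.+3) k => W (h k) ij.1 ij.2) (M := 1).
  by move=> ij k; apply: orthogonal_entry_le1; have [] := frW (h k).
have fge := increasing_seq_ge fh.
pose V0 := \matrix_(j, k) l (j, k).
have cV : entrywise_cvg (fun k => W (h (f k))) V0.
  by move=> j k; rewrite mxE; exact: lc (j, k).
have hfge k : (k <= h (f k))%N.
  exact: leq_trans (fge k) (hP (f k)).1.
have [cT ddT0] := orbit_limit_double_deflation incr gapP sigmaP gap_gt0 C_gt0
  deflT mi closest w0 bn0 hfge cV.
set T0 := V0 *m _ *m _ in cT ddT0.
have suppT0 : ~ singular_support lam sigma T0.
  by move=> sT0; have : set0 T0 by rewrite -smooth.
have [r [K [r0 K0 quad]]] := quadratic_shift incr gap_gt0 gapP simple ddT0 suppT0.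
have [k0 _ near_T0] := entrywise_cvg_near cT r0.
have [k1 Kk1] : exists k1 : nat, K <= k1%:R.
  by exists (Num.bound K); rewrite ltW // archi_boundP.
pose k := maxn k0 k1; have kT0 : `|T0 - orbit sigma T (h (f k))| < r.
  by apply: near_T0; rewrite /= leq_maxl.
have [[isoT _] frT pi] := defl (h (f k)).
have := quad _ _ _ kT0 isoT frT (le_trans (_ : 2^-1 <= 3 / 4) pi).
have half_le : 2^-1 <= 3 / 4 :> R by lra.
move=> /(_ half_le); apply/negP; rewrite -ltNge; apply: le_lt_trans (hP (f k)).2.
rewrite ler_wpM2r ?sqr_ge0 // (le_trans Kk1) // ler_nat.
by rewrite (leq_trans _ (fge k)) // leq_maxr.
Qed.

(** If some [b k] vanishes, so do the later ones; otherwise the quadratic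
    accuracy of the shift enters [orbit_contraction]. *)
Lemma orbit_cubic : exists (A : R) (K : nat), [/\ 0 < A, (0 < K)%N &
  forall k : nat, (K < k)%N -> `|b k.+1| <= A * `|b k| ^+ 3].
Proof.
have [[k0 bk0]|nz] := pselect (exists k, b k = 0).
  exists 1, k0.+1; split=> // k k0k.
  rewrite (orbit_vanish incr gapP sigmaP gap_gt0 C_gt0 deflT (k := k0)) //.
    by rewrite normr0 mul1r exprn_ge0.
  exact: leqW (ltnW (ltnW k0k)).
have bn0 k : b k != 0 by apply/eqP => bk; apply: nz; exists k.
have [A [K [A0 AP]]] := orbit_quadratic_shift bn0.
exists (4 / gap * A + 1), K.+1; split=> [||k Kk].
- by rewrite ltr_wpDl // mulr_ge0 // divr_ge0 // ltW.
- by [].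
apply: le_trans (orbit_contraction incr gapP sigmaP gap_gt0 C_gt0 deflT k) _.
apply: (@le_trans _ _ (4 / gap * A * `|b k| ^+ 3)); last first.
  by rewrite ler_wpM2r ?exprn_ge0 // lerDl.
rewrite exprSr [leRHS]mulrA ler_wpM2r // -[leRHS]mulrA ler_wpM2l ?divr_ge0 ?(ltW gap_gt0) //.
by rewrite real_normK ?num_real // AP // ltnW // ltnW.
Qed.

End Convergence.

Theorem theorem4 (R : realType) (n : nat) (lam : 'rV[R]_n.+3)
    (sigma : 'M[R]_n.+3 -> R) :
  increasing lam ->
  weak_ap (diag_mx lam) ->
  simple_shift lam sigma ->
  double_deflation lam `&` singular_support lam sigma = set0 ->
  exists eps : R, [/\ 0 < eps,
    invariant_under sigma (deflation lam eps) &
    forall T, deflation lam eps T -> unreduced T ->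
      (fun k => subdiag_last (iter k (shifted_step sigma) T)) @ \oo --> (0 : R) /\
      exists (C : R) (K : nat), [/\ 0 < C, (0 < K)%N &
        forall k : nat, (K < k)%N ->
          `|subdiag_last (iter k.+1 (shifted_step sigma) T)| <=
            C * `|subdiag_last (iter k (shifted_step sigma) T)| ^+ 3]].
Proof.
move=> incr [_ not_strong] simple smooth.
have [_ [C [C0 sigmaP]]] := simple.
have [gap [gap0 gapP]] := eigenvalue_gap incr.
exists (deflation_radius gap C); split.
- exact: deflation_radius_gt0.
- exact: (deflation_invariant incr gapP sigmaP gap0 C0).
move=> T defT unrT; have [[symT triT specT] _] := defT.
have [V frV] := eigenframe_exists incr symT specT.
have [i [deflT _]] := deflating_exists gapP sigmaP gap0 C0 defT frV.
have [i' i'i] : exists i' : 'I_n.+3, i' != i.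
  by exists (lift i ord0); rewrite eq_sym neq_lift.
have [m mi closest] := closest_eigenvalue incr i'i not_strong.
have w0 j := unreduced_last_neq0 j triT unrT frV.
split; first exact: (orbit_cvg0 incr gapP sigmaP gap0 C0 deflT).
exact: (orbit_cubic incr gapP sigmaP gap0 C0 deflT mi closest w0 simple smooth).
Qed.
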